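(* Let $G$ be a finite simple graph. The following conditions are equivalent: (i) $G$ is a theta-ring graph. (ii) $G$ can be constructed by $0$-, $1$-, $2$-clique-sums of chordal graphs and/or cycles. (iii) $G$ can be constructed by clique-sums of complete graphs and/or cycles. (iv) $G$ does not contain as an induced subgraph any graph from the following families: (a) $\theta$-partial wheels; (b) prisms, pyramids and thetas.
   Context: All graphs are finite and simple. A chorded-theta of $G$ is an induced subgraph $T$ of $G$ together with three paths $\mathcal{L}_1,\mathcal{L}_2,\mathcal{L}_3$ of $G$, each between two given non-adjacent vertices $x$ and $y$, such that $V(\mathcal{L}_i)\cap V(\mathcal{L}_j)=\{x,y\}$ for $1\le i<j\le 3$ and $T$ is the subgraph induced by $V(\mathcal{L}_1)\cup V(\mathcal{L}_2)\cup V(\mathcal{L}_3)$. A transversal triangle of $T$ is a triangle in $G$ having exactly one vertex in the interior $V(\mathcal{L}_i)\setminus\{x,y\}$ of each path $\mathcal{L}_i$, $i=1,2,3$. $G$ is a theta-ring graph if every chorded-theta of $G$ has a transversal triangle. Clique-sums: if $G=G_1\cup G_2$ and $K=G_1\cap G_2$ is a complete graph on $k$ vertices ($k=0$ meaning disjoint union), then $G$ is called the $k$-clique-sum (or clique-sum) of $G_1$ and $G_2$ in $K$; no edges of $K$ are deleted. ''Constructed by clique-sums of graphs in a family'' means obtained from members of the family by successive clique-sums (possibly none). A graph is chordal if each of its cycles of length at least $4$ has a chord. A partial wheel $W$ has vertex set $\{z,z_1,\dots,z_k\}$, where $C=(z_1,\dots,z_k,z_1)$ is a cycle (the rim), and its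 edges are the edges of $C$ and some edges between $z$ (the center) and vertices of $C$. A partial wheel $W$ with rim $C$ and center $z$ is a $\theta$-partial wheel if $|V(C)|\ge4$ and there exist two non-adjacent vertices in $V(C)\cap N_W(z)$. A prism consists of two vertex-disjoint triangles $(x_1,x_2,x_3,x_1)$ and $(y_1,y_2,y_3,y_1)$ and three pairwise vertex-disjoint paths $L_1,L_2,L_3$, with $L_i$ between $x_i$ and $y_i$, such that the subgraph induced by $V(L_i)\cup V(L_j)$ is a cycle for $1\le i<j\le3$. A pyramid consists of a vertex $w$, a triangle $(z_1,z_2,z_3,z_1)$ and three paths $P_1,P_2,P_3$, with $P_i$ between $w$ and $z_i$, such that $V(P_i)\cap V(P_j)=\{w\}$ and the subgraph induced by $V(P_i)\cup V(P_j)$ is a cycle for $1\le i<j\le3$, and at most one of $P_1,P_2,P_3$ has only one edge. A theta consists of two non-adjacent vertices $x,y$ and three paths $P,Q,R$ with ends $x$ and $y$ such that the union of every two of $P,Q,R$ is an induced cycle. *)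

(* Defs.v *)
From mathcomp Require Import all_boot.

Set Implicit Arguments.
Unset Strict Implicit.
Unset Printing Implicit Defensive.

Record sgraph := SGraph {
  vertex :> finType;
  adj : rel vertex;
  adj_sym : symmetric adj;
  adj_irrefl : irreflexive adj
}.

Section Induced.
Variables (G : sgraph) (S : {set G}).

Definition induced_vertex : finType := {v : G | v \in S}.
Definition induced_adj : rel induced_vertex := fun u v => adj (val u) (val v).

Fact induced_adj_sym : symmetric induced_adj.
Proof. by move=> u v; apply: adj_sym. Qed.

Fact induced_adj_irrefl : irreflexive induced_adj.
Proof. by move=> u; apply: adj_irrefl. Qed.

Definition induced : sgraph := SGraph induced_adj_sym induced_adj_irrefl.

End Induced.

Definition isomorphic (G H : sgraph) : Prop :=
  exists2 f : G -> H, bijective f & forall u v, adj (f u) (f v) = adj u v.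

Definition has_induced (G H : sgraph) : Prop :=
  exists S : {set G}, isomorphic (induced S) H.

Section Notions.
Variable G : sgraph.
Implicit Types (x y u v : G) (c L : seq G) (S D : {set G}).

(* A path is given by the sequence of all its vertices, both ends included. *)
Definition is_path x y L : bool :=
  if L is u :: p
  then [&& u == x, last u p == y, path (@adj G) u p & uniq L]
  else false.

Definition path_edge L u v : bool := infix [:: u; v] L || infix [:: v; u] L.

Definition is_cycle_seq c : bool := (2 < size c) && ucycleb (@adj G) c.

Definition cycle_edge c u v : bool :=
  [&& u \in c, v \in c & (next c u == v) || (next c v == u)].

Definition clique S : bool :=
  [forall u in S, forall v in S, (u != v) ==> adj u v].

Definition triangle D : bool := (#|D| == 3) && clique D.

Definition complete_graph : bool := clique [set: G].

Definition cycle_graph : Prop :=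
  exists c, [/\ is_cycle_seq c, forall v, v \in c
              & forall u v, adj u v = cycle_edge c u v].

Definition chordal : Prop :=
  forall c, is_cycle_seq c -> 4 <= size c ->
    exists u v, [/\ u \in c, v \in c, adj u v & ~~ cycle_edge c u v].

Definition interior x y L : {set G} := [set v in L] :\: [set x; y].

(* S is the vertex set of the chorded-theta, the subgraph being [induced S]. *)
Definition chorded_theta S x y (L : 'I_3 -> seq G) : Prop :=
  [/\ x != y /\ ~~ adj x y,
      forall i, is_path x y (L i),
      forall i j, i != j -> [set v in L i] :&: [set v in L j] = [set x; y]
    & S = \bigcup_(i < 3) [set v in L i]].

Definition transversal_triangle x y (L : 'I_3 -> seq G) D : Prop :=
  triangle D /\ forall i, #|D :&: interior x y (L i)| = 1.

Definition theta_ring : Prop :=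
  forall S x y (L : 'I_3 -> seq G), chorded_theta S x y L ->
    exists D, transversal_triangle x y L D.

End Notions.

(* The edges of the copy in G of the graph H under f : H -> G. *)
Definition image_edge (H G : sgraph) (f : H -> G) (u v : G) : bool :=
  [exists a, exists b, [&& f a == u, f b == v & adj a b]].

(* G is, up to isomorphism, a k-clique-sum of G1 and G2: the maps f1 and f2
   identify G1 and G2 with subgraphs of G whose union is G and whose
   intersection is complete on k vertices. *)
Definition clique_sum (k : nat) (G1 G2 G : sgraph) : Prop :=
  exists (f1 : G1 -> G) (f2 : G2 -> G),
    let K := (f1 @: [set: G1]) :&: (f2 @: [set: G2]) in
    [/\ injective f1 /\ injective f2,
        (f1 @: [set: G1]) :|: (f2 @: [set: G2]) = [set: G],
        forall u v, adj u v = image_edge f1 u v || image_edge f2 u v,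
        #|K| = k
      & forall u v, u \in K -> v \in K -> u != v ->
          image_edge f1 u v && image_edge f2 u v].

(* The graphs constructed from members of the family F by successive
   k-clique-sums with k allowed by [sizes]. *)
Inductive constructible (sizes : pred nat) (F : sgraph -> Prop) :
    sgraph -> Prop :=
| Constr_base G : F G -> constructible sizes F G
| Constr_sum k G1 G2 G :
    sizes k -> constructible sizes F G1 -> constructible sizes F G2 ->
    clique_sum k G1 G2 G -> constructible sizes F G.

Section Families.
Variable H : sgraph.

Definition partial_wheel (z : H) (c : seq H) : Prop :=
  [/\ is_cycle_seq c, z \notin c, forall v, v = z \/ v \in c
    & forall u v, u \in c -> v \in c -> adj u v = cycle_edge c u v].

Definition theta_partial_wheel : Prop :=
  exists (z : H) (c : seq H),
    [/\ partial_wheel z c, 4 <= size c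
      & exists u v, [/\ u \in c, v \in c, adj z u, adj z v
                      & u != v /\ ~~ adj u v]].

Definition induced_by_two (L1 L2 : seq H) : sgraph :=
  induced ([set v in L1] :|: [set v in L2]).

Definition prism : Prop :=
  exists (x y : 'I_3 -> H) (L : 'I_3 -> seq H),
    [/\ [/\ forall i j, i != j -> adj (x i) (x j),
            forall i j, i != j -> adj (y i) (y j)
          & forall i j, x i != y j],
        forall i, is_path (x i) (y i) (L i),
        forall i j, i != j -> [set v in L i] :&: [set v in L j] = set0,
        forall i j, i != j -> cycle_graph (induced_by_two (L i) (L j))
      & (forall v, exists i, v \in L i) /\
        (forall u v, adj u v ->
           [\/ exists i, path_edge (L i) u v,
               exists i j, u = x i /\ v = x j
             | exists i j, u = y i /\ v = y j])].

Definition pyramid : Prop :=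
  exists (w : H) (z : 'I_3 -> H) (P : 'I_3 -> seq H),
    [/\ forall i j, i != j -> adj (z i) (z j),
        forall i, is_path w (z i) (P i),
        forall i j, i != j -> [set v in P i] :&: [set v in P j] = [set w]
                    /\ cycle_graph (induced_by_two (P i) (P j)),
        (* a path with exactly one edge has exactly two vertices *)
        forall i j, size (P i) = 2 -> size (P j) = 2 -> i = j
      & (forall v, exists i, v \in P i) /\
        (forall u v, adj u v ->
           (exists i, path_edge (P i) u v) \/
           (exists i j, u = z i /\ v = z j))].

(* The union of two paths is an induced cycle when the subgraph induced by
   their vertices is a cycle all of whose edges belong to one of the paths. *)
Definition theta : Prop :=
  exists (x y : H) (P : 'I_3 -> seq H),
    [/\ x != y /\ ~~ adj x y,
        forall i, is_path x y (P i),
        forall i j, i != j -> cycle_graph (induced_by_two (P i) (P j)),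
        forall i j, i != j -> forall u v,
          u \in P i ++ P j -> v \in P i ++ P j ->
          adj u v = path_edge (P i) u v || path_edge (P j) u v
      & (forall v, exists i, v \in P i) /\
        (forall u v, adj u v -> exists i, path_edge (P i) u v)].

End Families.

(* Main.v *)
(* (i) => (iv): theta-rings are closed under induced subgraphs, and each
   obstruction carries three paths between two nonadjacent vertices, two of whose
   interiors are too sparsely joined for a transversal triangle.

   (iv) => (ii): if G is not chordal, take a hole C. A component H of G - C attaches
   to a clique of C, of size at most 2, which then splits G. Otherwise let p be a
   shortest path in H between neighbours of nonadjacent vertices of C. By
   minimality p is induced, and all of p but its last vertex attaches to a clique
   of C, as does all of p but its first vertex. If these two cliques share a vertex
   w, then w is the centre of a wheel whose rim consists of p and C - w; if they are
   disjoint, they cut C into two arcs which together with p form a theta, a pyramid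
   or a prism, according to their sizes.

   (ii) => (iii) is Dirac's decomposition of chordal graphs along clique cutsets.

   (iii) => (i): a chorded theta with its two ends in one part of a clique-sum can be
   shortcut through the clique so as to lie in that part; if the ends are separated
   by the clique, all three paths meet it, and there they span a triangle. *)

(* The link is shortest among all links joining any two nonadjacent vertices of the hole, not among
   those of one given pair; this is what makes the attachments of both truncations cliques. The
   truncations overlap in the inner vertices of the link, so when their cliques are disjoint the
   inner vertices see nothing of the hole, and only the two ends attach.

   A hole has no triangle, so each attachment clique has one or two vertices. A single vertex is
   kept as a common end of three arcs, while an edge is dissolved into the tips of two arcs. Thetas,
   pyramids and prisms thus become one computation, with ends given by sequences of length at most
   1. When both cliques are single vertices, it is their nonadjacency that keeps the two arcs of the
   hole nonempty. *)
Require Import Defs.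
From mathcomp Require Import all_boot.

Set Implicit Arguments.
Unset Strict Implicit.
Unset Printing Implicit Defensive.

(** * Consecutive vertices of a sequence *)

Section Steps.
Variable T : eqType.
Implicit Types (s p : seq T) (u v x y : T).

(** One direction of [path_edge]. Unlike the symmetric relation it tells successor from predecessor,
    and so it can be compared with [next]. *)
Definition step s u v := infix [:: u; v] s.

Lemma step_cons x y s u v :
  step (x :: y :: s) u v = (u == x) && (v == y) || step (y :: s) u v.
Proof. by rewrite /step infix_consl /= prefix0s andbT. Qed.

Lemma step_one x u v : step [:: x] u v = false.
Proof. by rewrite /step infixs1 /= !eqseq_cons andbF. Qed.

Lemma step_split s1 x s2 u v :
  step (s1 ++ x :: s2) u v = step (rcons s1 x) u v || step (x :: s2) u v.
Proof.
elim: s1 => [|y s1 IH]; first by rewrite step_one.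
case: s1 IH => [_|z s1 IH]; first by rewrite /= !step_cons step_one orbF.
by rewrite /= !step_cons -!cat_cons IH orbA.
Qed.

Lemma step_rev s u v : step (rev s) u v = step s v u.
Proof. by rewrite /step -infix_rev revK. Qed.

Lemma step_mem s u v : step s u v -> u \in s /\ v \in s.
Proof.
by case/infixP=> s1 [s2 ->]; rewrite !mem_cat !inE !eqxx !orbT.
Qed.

Lemma step_behead x s u v : step (x :: s) u v -> v \in s.
Proof.
elim: s x => [|y s IH] x; first by rewrite step_one.
by rewrite step_cons inE => /orP[/andP[_ ->]//|/IH->]; rewrite orbT.
Qed.

Lemma step_head x s u : uniq (x :: s) -> step (x :: s) x u = (s != [::]) && (u == head x s).
Proof.
case: s => [|y s] /=; first by rewrite step_one.
rewrite step_cons eqxx /= => /andP[xs _]; case: eqP => //= _.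
by apply: contraNF xs => /step_mem[].
Qed.

Lemma step_to_head x s u : uniq (x :: s) -> step (x :: s) u x = false.
Proof. by move=> /= /andP[xs _]; apply: contraNF xs => /step_behead. Qed.

Lemma step_last x s u :
  uniq (rcons s x) -> step (rcons s x) u x = (s != [::]) && (u == last x s).
Proof.
move=> Us; rewrite -step_rev rev_rcons step_head; last by rewrite -rev_rcons rev_uniq.
case: (lastP s) => // s' y; rewrite rev_rcons last_rcons.
by case: s' {Us}.
Qed.

Lemma step_from_last x s u : uniq (rcons s x) -> step (rcons s x) x u = false.
Proof.
by move=> Us; rewrite -step_rev rev_rcons step_to_head // -rev_rcons rev_uniq.
Qed.

Lemma sorted_step (e : rel T) s :
  sorted e s <-> (forall u v, step s u v -> e u v).
Proof.
case: s => [|x s] //; elim: s x => [|y s IH] x.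
  by split=> // _ u v; rewrite step_one.
split=> [/= /andP[exy pys] u v|H].
  by rewrite step_cons => /orP[/andP[/eqP-> /eqP->]//|]; apply: (IH y).1.
rewrite /= H ?step_cons ?eqxx //=; apply: (IH y).2 => u v suv.
by apply: H; rewrite step_cons suv orbT.
Qed.

Lemma step_next x s u v : uniq (x :: s) ->
  step (x :: rcons s x) u v = (u \in x :: s) && (next (x :: s) u == v).
Proof.
(* The closing vertex is generalised, as in [next_at]: the induction moves the head while the
   closing vertex stays fixed. *)
suff next_atE z : uniq (x :: s) ->
    step (x :: rcons s z) u v = (u \in x :: s) && (next_at u z x s == v) by exact: next_atE.
elim: s x => [|y s IH] x.
  by rewrite /= step_cons step_one orbF inE; case: (eqVneq u x) => //= _; rewrite eq_sym.
rewrite [next_at _ _ _ _]/= => /= /andP[xs Us].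
rewrite step_cons inE (IH y) //; case: (eqVneq u x) => [->|_] //=.
by rewrite (negPf xs) orbF eq_sym.
Qed.

End Steps.

Section Edges.
Variable G : sgraph.
Implicit Types (u v x y : G) (s c : seq G).

Lemma path_edgeE s u v : path_edge s u v = step s u v || step s v u.
Proof. by []. Qed.

Lemma path_edgeC s u v : path_edge s u v = path_edge s v u.
Proof. by rewrite !path_edgeE orbC. Qed.

Lemma path_edge_rev s u v : path_edge (rev s) u v = path_edge s u v.
Proof. by rewrite !path_edgeE !step_rev orbC. Qed.

Lemma path_edge_mem s u v : path_edge s u v -> u \in s /\ v \in s.
Proof. by case/orP=> /step_mem[]. Qed.

Lemma path_edge_one x u v : path_edge [:: x] u v = false.
Proof. by rewrite path_edgeE !step_one. Qed.

Definition same_pair u v x y := (u == x) && (v == y) || (u == y) && (v == x).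

Lemma path_edge_cons x y s u v :
  path_edge (x :: y :: s) u v = same_pair u v x y || path_edge (y :: s) u v.
Proof.
rewrite !path_edgeE !step_cons /same_pair [(v == x) && _]andbC.
by rewrite orbACA.
Qed.

Lemma path_edge_split s1 x s2 u v :
  path_edge (s1 ++ x :: s2) u v =
  path_edge (rcons s1 x) u v || path_edge (x :: s2) u v.
Proof.
rewrite !path_edgeE !(step_split s1).
by rewrite -!orbA; do !bool_congr.
Qed.

Lemma path_edge_rcons s x y u v :
  path_edge (rcons (rcons s x) y) u v =
  path_edge (rcons s x) u v || same_pair u v x y.
Proof.
by rewrite -cats1 cat_rcons path_edge_split path_edge_cons path_edge_one orbF.
Qed.

Lemma path_edge_cat s1 x y s2 u v :
  path_edge (rcons s1 x ++ y :: s2) u v =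
  [|| path_edge (rcons s1 x) u v, same_pair u v x y | path_edge (y :: s2) u v].
Proof. by rewrite cat_rcons path_edge_split path_edge_cons. Qed.

Lemma path_edge_head x s u : uniq (x :: s) ->
  path_edge (x :: s) x u = (s != [::]) && (u == head x s).
Proof. by move=> Us; rewrite path_edgeE step_head // step_to_head // orbF. Qed.

Lemma path_edge_last x s u : uniq (rcons s x) ->
  path_edge (rcons s x) x u = (s != [::]) && (u == last x s).
Proof. by move=> Us; rewrite path_edgeE step_last // step_from_last. Qed.

Lemma sorted_adj s :
  sorted (@adj G) s <-> (forall u v, path_edge s u v -> adj u v).
Proof.
split=> [/sorted_step H u v|H]; first by case/orP=> /H //; rewrite adj_sym.
by apply/sorted_step => u v suv; apply: H; rewrite path_edgeE suv.
Qed.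

(** Repeating the first vertex at the end turns a cycle into a sequence, whose edges can then be
    split and concatenated like those of a path. *)
Lemma cycle_edgeE x s u v : uniq (x :: s) ->
  cycle_edge (x :: s) u v = path_edge (x :: rcons s x) u v.
Proof.
move=> Us; rewrite path_edgeE !step_next // /cycle_edge.
apply/idP/idP=> [/and3P[-> ->]//|].
case/orP=> /andP[uc /eqP<-]; rewrite mem_next uc eqxx ?orbT //=.
Qed.

Lemma cycle_edgeC c u v : cycle_edge c u v = cycle_edge c v u.
Proof. by rewrite /cycle_edge; case: (u \in c); case: (v \in c); rewrite //= orbC. Qed.

Lemma cycle_edge_rot n c u v : uniq c -> cycle_edge (rot n c) u v = cycle_edge c u v.
Proof. by move=> Uc; rewrite /cycle_edge !mem_rot !next_rot. Qed.

Lemma cycle_edge_rev c u v : uniq c -> cycle_edge (rev c) u v = cycle_edge c u v.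
Proof.
move=> Uc; rewrite /cycle_edge !mem_rev !next_rev //.
by rewrite !(can2_eq (next_prev Uc) (prev_next Uc)) orbC !(eq_sym _ (next c _)).
Qed.

(** The last clause forbids chords and at the same time provides the edges of the cycle, so
    [is_cycle_seq] follows ([is_cycle_seq_chordless]). *)
Definition hole c :=
  [/\ uniq c, 4 <= size c & {in c &, forall u v, adj u v = cycle_edge c u v}].

End Edges.

(** * Embeddings and induced cycles *)

Section Embeddings.

(** [has_induced G H] amounts to an embedding of [H] in [G]; embeddings compose and carry paths and
    cycles along by [map]. *)
Definition embedding (H G : sgraph) (f : H -> G) :=
  injective f /\ forall u v, adj (f u) (f v) = adj u v.

Lemma seq_preimage (T : eqType) (H : finType) (f : H -> T) (s : seq T) :
  (forall x, x \in s -> exists y, f y = x) -> exists t, s = map f t.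
Proof.
elim: s => [|x s IH] fs; first by exists [::].
have [y <-] := fs x (mem_head _ _).
have [|t ->] := IH; first by move=> z zs; apply: fs; rewrite inE zs orbT.
by exists (y :: t).
Qed.

Lemma induced_embedding (G : sgraph) (S : {set G}) :
  embedding (val : induced S -> G).
Proof. by split; first exact: val_inj. Qed.

Lemma induced_preimage (G : sgraph) (S : {set G}) x :
  x \in S -> exists y : induced S, val y = x.
Proof. by move=> xS; exists (exist _ x xS). Qed.

Lemma card_induced (G : sgraph) (S : {set G}) : #|induced S| = #|S|.
Proof. by rewrite /= card_sig; apply: eq_card => x; rewrite inE. Qed.

Lemma is_path_map (H G : sgraph) (f : H -> G) x y L : embedding f ->
  is_path (f x) (f y) (map f L) = is_path x y L.
Proof.
case=> f_inj f_adj; case: L => [|u p] //=.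
rewrite (inj_eq f_inj) last_map (inj_eq f_inj) path_map (mem_map f_inj) map_inj_uniq //.
by congr [&& _, _, _ & _]; apply: eq_path => a b /=; rewrite f_adj.
Qed.

Lemma cycle_edge_map (H G : sgraph) (f : H -> G) c u v : injective f -> uniq c ->
  cycle_edge (map f c) (f u) (f v) = cycle_edge c u v.
Proof.
by move=> f_inj Uc; rewrite /cycle_edge !mem_map // !next_map // !inj_eq.
Qed.

Lemma cycle_seq_map (H G : sgraph) (f : H -> G) c : embedding f ->
  is_cycle_seq (map f c) = is_cycle_seq c.
Proof.
case=> f_inj f_adj; rewrite /is_cycle_seq /ucycleb size_map map_inj_uniq //.
congr (_ && (_ && _)); case: c => //= x c.
by rewrite -map_rcons path_map; apply: eq_path => a b /=; rewrite f_adj.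
Qed.

Lemma cycle_seq_edge (G : sgraph) (c : seq G) u v :
  is_cycle_seq c -> cycle_edge c u v -> adj u v.
Proof.
case/and3P=> _ cc Uc /and3P[uc vc /orP[]/eqP<-]; first exact: next_cycle.
by rewrite adj_sym; apply: next_cycle.
Qed.

Lemma is_cycle_seq_chordless (G : sgraph) (c : seq G) : uniq c -> 2 < size c ->
  {in c &, forall u v, adj u v = cycle_edge c u v} -> is_cycle_seq c.
Proof.
move=> Uc c_gt2 adjc; rewrite /is_cycle_seq /ucycleb c_gt2 Uc andbT /=.
apply: cycle_from_next => // x xc.
by rewrite adjc ?mem_next // /cycle_edge mem_next xc eqxx.
Qed.

Lemma cycle_graph_induced (G : sgraph) (S : {set G}) (c : seq G) :
  uniq c -> 2 < size c -> S =i c ->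
  {in c &, forall u v, adj u v = cycle_edge c u v} -> cycle_graph (induced S).
Proof.
move=> Uc c_gt2 Sc adjc.
have [|c' Ec] := @seq_preimage _ (induced S) val c.
  by move=> x; rewrite -Sc; apply: induced_preimage.
have vE := induced_embedding S.
have c'T v : v \in c' by rewrite -(mem_map val_inj) -Ec -Sc; apply: valP.
exists c'; split=> //.
  by rewrite -(cycle_seq_map c' vE) -Ec is_cycle_seq_chordless.
have Uc' : uniq c' by rewrite -(map_inj_uniq val_inj) -Ec.
move=> u v; rewrite -(cycle_edge_map _ _ vE.1 Uc') -Ec -adjc //.
  by rewrite Ec map_f.
by rewrite Ec map_f.
Qed.

(** Rotated to start at [x], the cycle shows the two neighbours as its second and last vertices;
    they differ because it has at least three. *)
Lemma cycle_graph_degree (G : sgraph) (x : G) : cycle_graph G ->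
  exists a b, a != b /\ forall v, adj x v = (v == a) || (v == b).
Proof.
case=> c [cc cT adjc]; have /and3P[c_gt2 _ Uc] := cc.
have [i s Ec] := rot_to (cT x).
have Us : uniq (x :: s) by rewrite -Ec rot_uniq.
have : 2 < size (x :: s) by rewrite -Ec size_rot.
have {adjc} adjx v : adj x v = path_edge (x :: rcons s x) x v.
  by rewrite adjc -(cycle_edge_rot i) // Ec cycle_edgeE.
case/lastP: s Us adjx {Ec} => // s b; case: s => // a s Us adjx _.
exists a, b; move: Us; rewrite /= mem_rcons !inE mem_rcons inE.
case/and3P=> /norP[xb /norP[xa xs]] /norP[ab as_] Us; split=> // v.
rewrite adjx /= path_edge_cons -!rcons_cons path_edge_rcons /same_pair eqxx /=.
rewrite (negPf xa) (negPf xb) /= orbF.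
suff /negPf-> : ~~ path_edge (rcons (a :: s) b) x v by [].
apply: contraT => /negPn/path_edge_mem[].
by rewrite mem_rcons !inE (negPf xb) (negPf xa) (negPf xs).
Qed.

Lemma cycle_graph_induced_degree (G : sgraph) (S : {set G}) (x : G) :
  cycle_graph (induced S) -> x \in S ->
  exists a b, [/\ a \in S, b \in S, a != b &
    {in S, forall v, adj x v = (v == a) || (v == b)}].
Proof.
move=> cS xS; have [a [b [ab adjx]]] := @cycle_graph_degree (induced S) (exist _ x xS) cS.
exists (val a), (val b); split; rewrite ?(valP a) ?(valP b) //.
by move=> v vS; apply: (adjx (exist _ v vS)).
Qed.

End Embeddings.

(** * Transversal triangles as three pairwise adjacent inner vertices *)

Section Transversal.
Variable G : sgraph.
Implicit Types (x y u v : G) (L : 'I_3 -> seq G).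

Lemma interiorE x y (L : seq G) v :
  (v \in interior x y L) = [&& v != x, v != y & v \in L].
Proof. by rewrite !inE negb_or andbA. Qed.

(** The interiors are pairwise disjoint, so a choice of one vertex in each is injective, and its
    image meets each interior exactly once. *)
Lemma transversal_triangleP x y L :
  (forall i j, i != j -> [set v in L i] :&: [set v in L j] = [set x; y]) ->
  (exists D, transversal_triangle x y L D) <->
  (exists d : 'I_3 -> G, (forall i, d i \in interior x y (L i)) /\
     forall i j, i != j -> adj (d i) (d j)).
Proof.
move=> LI.
have intD i j v : v \in interior x y (L i) -> v \in interior x y (L j) -> i = j.
  rewrite !interiorE => /and3P[vx vy vi] /and3P[_ _ vj].
  apply/eqP; apply: contraT => /LI/setP/(_ v).
  by rewrite !inE vi vj (negPf vx) (negPf vy).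
split=> [[D [/andP[_ /forall_inP cD] D1]]|[d [di adjd]]].
  have [|d dI] := @fin_all_exists _ _ (fun i v => v \in D :&: interior x y (L i)).
    by move=> i; apply/set0Pn; rewrite -card_gt0 D1.
  exists d.
  split=> [i|i j ij]; first by have := dI i; rewrite inE => /andP[].
  have /setIP[iD ii] := dI i; have /setIP[jD jj] := dI j.
  have /forall_inP/(_ _ jD)/implyP := cD _ iD; apply.
  by apply: contraNneq ij => Eij; apply/eqP; apply: intD ii _; rewrite Eij.
have d_inj : injective d by move=> i j Eij; apply: intD (di i) _; rewrite Eij.
exists (d @: [set: 'I_3]); split=> [|i].
  rewrite /triangle card_imset // cardsT card_ord eqxx /=.
  apply/forall_inP => _ /imsetP[i _ ->]; apply/forall_inP => _ /imsetP[j _ ->].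
  by apply/implyP; rewrite (inj_eq d_inj); apply: adjd.
rewrite (_ : _ :&: _ = [set d i]) ?cards1 //; apply/setP=> v; rewrite in_setI inE.
apply/andP/eqP=> [[/imsetP[j _ ->] /(intD _ _ _ (di j))->]//|->].
by split; first exact: imset_f.
Qed.

Definition theta_paths x y L :=
  [/\ x != y, ~~ adj x y, forall i, is_path x y (L i)
    & forall i j v, i != j -> v \in L i -> v \in L j -> v \in [:: x; y]].

Lemma is_path_ends x y (L : seq G) : is_path x y L -> x \in L /\ y \in L.
Proof.
by case: L => //= u p /and4P[/eqP<- /eqP<- _ _]; rewrite mem_head mem_last.
Qed.

Lemma theta_ringP : theta_ring G <-> forall x y L, theta_paths x y L ->
  exists d : 'I_3 -> G, (forall i, d i \in interior x y (L i)) /\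
    forall i j, i != j -> adj (d i) (d j).
Proof.
split=> tG => [x y L [xy nxy pL IL]|S x y L [[xy nxy] pL IL ES]].
  have LI i j : i != j -> [set v in L i] :&: [set v in L j] = [set x; y].
    move=> ij; apply/setP=> v; rewrite !inE; apply/andP/orP=> [[vi vj]|].
      by have := IL _ _ _ ij vi vj; rewrite !inE => /orP.
    have [[xi yi] [xj yj]] := (is_path_ends (pL i), is_path_ends (pL j)).
    by case=> /eqP->.
  by apply/(transversal_triangleP LI); apply: tG.
apply/(transversal_triangleP IL); apply: tG; split=> // i j v ij vi vj.
by have /setP/(_ v) := IL _ _ ij; rewrite !inE vi vj => <-.
Qed.

End Transversal.

Lemma theta_ring_embedding (H G : sgraph) (f : H -> G) :
  embedding f -> theta_ring G -> theta_ring H.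
Proof.
move=> fE /theta_ringP tG; have [f_inj f_adj] := fE.
apply/theta_ringP => x y L [xy nxy pL IL].
have [|d [dI adjd]] := tG (f x) (f y) (fun i => map f (L i)).
  split=> [|||i j _ ij /mapP[v vi ->]]; rewrite ?(inj_eq f_inj) ?f_adj //.
    by move=> i; rewrite is_path_map.
  rewrite mem_map // => vj; have := IL _ _ _ ij vi vj.
  by rewrite !inE !(inj_eq f_inj).
have [|e dE] := @fin_all_exists _ _ (fun i v => f v = d i).
  by move=> i; have := dI i; rewrite interiorE => /and3P[_ _ /mapP[v _ ->]]; exists v.
exists e; split=> [i|i j ij]; last by rewrite -f_adj !dE adjd.
by have := dI i; rewrite -dE !interiorE !(inj_eq f_inj) mem_map.
Qed.

(** * Inner vertices of paths and arcs of cycles *)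

Section PathFacts.
Variable G : sgraph.
Implicit Types (x y u v a b : G) (P Q L c : seq G).

Lemma is_pathE x y L : is_path x y (x :: rcons L y) =
  uniq (x :: rcons L y) && sorted (@adj G) (x :: rcons L y).
Proof. by rewrite /is_path last_rcons !eqxx /= andbC. Qed.

Lemma is_path_uniq x y L : is_path x y L -> uniq L.
Proof. by case: L => //= u p /and4P[]. Qed.

Lemma is_path_adj x y L u v : is_path x y L -> path_edge L u v -> adj u v.
Proof.
by case: L => //= w p /and4P[_ _ pp _]; apply: (sorted_adj (w :: p)).1.
Qed.

Lemma is_path_split x y L : x != y -> is_path x y L -> exists A, L = x :: rcons A y.
Proof.
move=> xy; case: L => //= u p /and4P[/eqP-> /eqP yE _ _].
by case/lastP: p yE => /= [Exy|A z]; [rewrite Exy eqxx in xy|rewrite last_rcons => ->; exists A].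
Qed.

Lemma is_path_last x y L : is_path x y L -> exists A, L = rcons A y.
Proof.
case: L => //= u p /and4P[_ /eqP<- _ _].
by case/lastP: p => [|p z]; [exists [::]|exists (u :: p); rewrite last_rcons].
Qed.

Lemma is_path_last_edge x y L u v : is_path x y L ->
  path_edge L y u -> path_edge L y v -> u = v.
Proof.
move=> pL; have [A E] := is_path_last pL; have := is_path_uniq pL; rewrite E => UA.
by rewrite !path_edge_last // => /andP[_ /eqP->] /andP[_ /eqP->].
Qed.

Lemma is_path_interior_edges x y L v : is_path x y L -> v \in L -> v != x -> v != y ->
  exists a b, [/\ a != b, path_edge L v a & path_edge L v b].
Proof.
move=> pL vL vx vy; have U := is_path_uniq pL.
have xy : x != y.
  (* A path with equal ends is a single vertex, which leaves no room for [v]. *)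
  apply: contra_neq vx => Exy; case: L pL vL U => //= u p.
  case/and4P=> /eqP-> /eqP; rewrite -Exy => lx _ Up.
  suff -> : p = [::] by rewrite inE => /eqP.
  by case/lastP: p lx Up => // p z; rewrite last_rcons => -> ; rewrite mem_rcons mem_head.
have [A EL] := is_path_split xy pL.
move: vL U; rewrite EL inE (negPf vx) mem_rcons inE (negPf vy) /=.
case/splitPr=> A1 A2; rewrite rcons_cat rcons_cons.
rewrite -[x :: _ ++ _]cat_cons -[_ && _]/(uniq ((x :: A1) ++ v :: rcons A2 y)) (lastI x A1).
move: (belast x A1) (last x A1) => B1 b1.
have [b2 [B2 ->]] : exists b2 B2, rcons A2 y = b2 :: B2.
  by case: (A2) => [|b B] /=; [exists y, [::]|exists b, (rcons B y)].
move=> UL; exists b1, b2; split; last 2 first.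
- by rewrite path_edge_cat /same_pair !eqxx ?orbT.
- by rewrite path_edge_split path_edge_cons /same_pair !eqxx ?orbT.
move: UL; rewrite cat_uniq => /and3P[_ /hasPn/(_ b2)].
by rewrite mem_rcons !inE eqxx orbT negb_or eq_sym => /(_ isT)/andP[].
Qed.

(** Two vertices cut a cycle into two paths; the second is read backwards so that both run from [u]
    to [v]. *)
Lemma cycle_edge_split u A v B a b : uniq (u :: A ++ v :: B) ->
  cycle_edge (u :: A ++ v :: B) a b =
  path_edge (u :: rcons A v) a b || path_edge (u :: rcons (rev B) v) a b.
Proof.
move=> Uc; rewrite cycle_edgeE // rcons_cat -cat_cons rcons_cons path_edge_split rcons_cons.
by rewrite -(path_edge_rev (u :: rcons (rev B) v)) rev_cons rev_rcons revK.
Qed.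

End PathFacts.

Lemma path_edge_notin (G : sgraph) (L : seq G) u v :
  (u \notin L) || (v \notin L) -> path_edge L u v = false.
Proof.
by move=> uvL; apply: contraTF uvL => /path_edge_mem[-> ->].
Qed.

(** * Obstructions are not theta-rings *)

Section ObstructionsNotThetaRing.
Variable G : sgraph.
Implicit Types (x y u v a b : G) (P Q L c : seq G).

(* A common inner vertex has its two cycle neighbours on both paths;
   following the paths to [y] leaves [y] only one neighbour on the cycle. *)
Lemma induced_cycle_paths_meet x y P Q :
  x != y -> is_path x y P -> is_path x y Q ->
  cycle_graph (induced_by_two P Q) ->
  {in P ++ Q &, forall u v, adj u v = path_edge P u v || path_edge Q u v} ->
  forall v, v \in P -> v \in Q -> v \in [:: x; y].
Proof.
move=> xy pP pQ cyc adjPQ v vP vQ; rewrite !inE; apply: contraT => /norP[vx vy].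
have SE z : (z \in [set v in P] :|: [set v in Q]) = (z \in P ++ Q).
  by rewrite !inE mem_cat.
have nbrs z : z \in P ++ Q -> exists a b, [/\ a \in P ++ Q, b \in P ++ Q, a != b &
    {in P ++ Q, forall w, adj z w = (w == a) || (w == b)}].
  rewrite -SE => /(cycle_graph_induced_degree cyc)[a [b [aS bS ab zab]]].
  by exists a, b; rewrite -!SE; split=> // w; rewrite -SE; apply: zab.
pose I z := [&& z \in P, z \in Q, z != x & z != y].
(* An inner vertex has two neighbours along its path and only two on the whole cycle, so all its
   edges run along that path. *)
have sub_edge L z w : is_path x y L -> {subset L <= P ++ Q} ->
    (forall a b, path_edge L a b -> adj a b) -> I z -> z \in L -> w \in P ++ Q ->
    adj z w -> path_edge L z w.
  move=> pL LS Ladj /and4P[_ _ zx zy] zL wS zw.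
  have [a [b [ab za zb]]] := is_path_interior_edges pL zL zx zy.
  have [a' [b' [_ _ _ zab]]] := nbrs z (LS _ zL).
  have /path_edge_mem[_ /LS aS] := za; have /path_edge_mem[_ /LS bS] := zb.
  have := zab w wS; have := zab a aS; have := zab b bS; rewrite zw !Ladj //.
  move=> /esym/orP[]/eqP Eb /esym/orP[]/eqP Ea /esym/orP[]/eqP Ew;
    by subst a b w; rewrite // eqxx in ab.
have PS : {subset P <= P ++ Q} by move=> z; rewrite mem_cat => ->.
have QS : {subset Q <= P ++ Q} by move=> z; rewrite mem_cat orbC => ->.
have eP := @is_path_adj _ x y P _ _ pP; have eQ := @is_path_adj _ x y Q _ _ pQ.
have Iedge z w : I z -> path_edge P z w -> path_edge Q z w.
  move=> Iz zw; have /and4P[zP zQ _ _] := Iz.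
  have /path_edge_mem[_ wP] := zw.
  exact: sub_edge pQ QS eQ Iz zQ (PS _ wP) (eP _ _ zw).
have [b Ib yb] : exists2 b, I b & path_edge P b y.
  have Iv : I v by rewrite /I vP vQ vx vy.
  have [A EP] := is_path_split xy pP.
  have vA : v \in A by move: (vP); rewrite EP inE (negPf vx) mem_rcons inE (negPf vy).
  have [A1 [A2 EA]] : exists A1 A2, A = A1 ++ v :: A2 by case/splitPr: vA => A1 A2; exists A1, A2.
  rewrite EA rcons_cat -cat_cons in EP.
  have U := is_path_uniq pP.
  elim: A2 v A1 {A vA EA vP vQ vx vy} Iv EP => [|w A2 IH] v A1 Iv EP.
    by exists v; rewrite // EP path_edge_split orbC path_edge_cons /same_pair !eqxx.
  apply: (IH w (rcons A1 v)); last by rewrite EP -rcons_cons cat_rcons.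
  have vw : path_edge P v w by rewrite EP path_edge_split orbC path_edge_cons /same_pair !eqxx.
  have /path_edge_mem[_ wQ] := Iedge _ _ Iv vw.
  have /path_edge_mem[_ wP] := vw.
  rewrite /I wP wQ /=; move: U; rewrite EP /= => /andP[].
  rewrite mem_cat !inE !negb_or => /and4P[_ _ xw _].
  rewrite cat_uniq => /and3P[_ _ /and3P[_ wy _]].
  by rewrite eq_sym xw; apply: contraNneq wy => ->; rewrite mem_rcons mem_head.
have yb' := Iedge _ _ Ib yb; rewrite !(path_edgeC _ b) in yb yb'.
have [xP yP] := is_path_ends pP.
have [a1 [a2 [a1S a2S a12 yE]]] := nbrs y (PS _ yP).
have yS := PS _ yP.
have toy a : a \in P ++ Q -> adj y a -> a = b.
  move=> aS; rewrite adjPQ // => /orP[] ya.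
    exact: is_path_last_edge pP ya yb.
  exact: is_path_last_edge pQ ya yb'.
have Ea1 : a1 = b by apply: toy; rewrite ?yE ?eqxx.
have Ea2 : a2 = b by apply: toy; rewrite ?yE ?eqxx ?orbT.
by rewrite Ea1 Ea2 eqxx in a12.
Qed.

(** That the three paths meet only at their ends is not part of [theta]; it comes from the cycle
    condition. An edge between two interiors would then lie on neither path nor on the third. *)
Lemma theta_not_theta_ring : theta G -> ~ theta_ring G.
Proof.
case=> x [y [P [[xy nxy] pP cP adjP [_ adjT]]]] /theta_ringP tG.
have meet i j v : i != j -> v \in P i -> v \in P j -> v \in [:: x; y].
  by move=> ij; apply: induced_cycle_paths_meet => //; [apply: cP|move=> u w; apply: adjP].
have [//|d [dI /(_ ord0 (inord 1))]] := tG x y P.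
rewrite -val_eqE /= inordK // => /(_ isT)/adjT[i /path_edge_mem[d0i d1i]].
have end_eq j : d j \in P i -> j = i.
  move=> dji; apply/eqP; apply: contraT => ji; have := dI j; rewrite interiorE => /and3P[dx dy dj].
  by have := meet _ _ _ ji dj dji; rewrite !inE (negPf dx) (negPf dy).
by have := end_eq _ d1i; rewrite -(end_eq _ d0i) => /(congr1 val); rewrite /= inordK.
Qed.

(** The chorded theta consists of the two arcs of the rim between [u] and [v] and of the path
    through the centre. An edge between the interiors of the arcs would be a chord of the rim. *)
Lemma theta_partial_wheel_not_theta_ring : theta_partial_wheel G -> ~ theta_ring G.
Proof.
case=> z [c [[cc zc _ adjc] _ [u [v [uc vc zu zv [uv nuv]]]]]] /theta_ringP tG.
have /and3P[_ _ Uc] := cc.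
have [n t Ec] := rot_to uc.
have {Ec cc} [Uut adjut vt zt] : [/\ uniq (u :: t),
    {in u :: t &, forall a b, adj a b = cycle_edge (u :: t) a b}, v \in t & z \notin u :: t].
  rewrite -Ec rot_uniq mem_rot; split=> // [a b|].
    by rewrite !mem_rot cycle_edge_rot //; apply: adjc.
  by have := vc; rewrite -(mem_rot n) Ec inE eq_sym (negPf uv).
case/splitPr: vt Uut adjut zt => A B Uut adjut zt.
pose L (i : 'I_3) := u :: rcons (nth [::] [:: A; rev B; [:: z]] i) v.
have inL k w : (w \in L k) =
    (w \in [:: u; v]) || (w \in nth [::] [:: A; rev B; [:: z]] k).
  by rewrite /L !inE mem_rcons inE orbA.
have memt w : (w \in u :: A ++ v :: B) = [|| w == u, w == v, w \in A | w \in B].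
  by rewrite inE mem_cat inE; do !bool_congr.
have edgeL (k : 'I_3) a b : k < 2 -> path_edge (L k) a b -> adj a b.
  move=> k2 ab; have [aL bL] := path_edge_mem ab.
  have sub w : w \in L k -> w \in u :: A ++ v :: B.
    rewrite inL memt !inE -orbA => /or3P[->|->|]; rewrite ?orbT //.
    by move: k2; case: (k) => [[|[|[|]]]] //= _ _; rewrite ?mem_rev => ->; rewrite !orbT.
  rewrite adjut ?sub // cycle_edge_split //.
  by move: k2 ab; rewrite /L; case: (k) => [[|[|[|]]]] //= _ _ ->; rewrite ?orbT.
move: zt; rewrite memt !negb_or => /and4P[zu' zv' zA zB].
have := Uut; rewrite /= mem_cat inE !negb_or cat_uniq /= negb_or.
case/and5P=> /and3P[uA _ uB] UA /andP[vA AB] vB UB.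
have AB' w : w \in A -> w \in B -> false by move=> wA wB; move/hasPn: AB => /(_ w wB)/negP.
have [|d [dI adjd]] := tG u v L.
  split=> // [i|i j w].
    rewrite is_pathE; apply/andP; split.
      rewrite cons_uniq mem_rcons rcons_uniq inE (negPf uv) /=.
      case: (i) => [[|[|[|]]]] //= _; rewrite ?mem_rev ?rev_uniq ?inE.
      - by rewrite uA vA.
      - by rewrite uB vB.
      - by rewrite eq_sym zu' eq_sym zv'.
    apply/sorted_adj => a b; rewrite -/(L i).
    case: (ltnP i 2) => [/edgeL|i2]; first exact.
    have -> : L i = [:: u; z; v].
      by move: i2; rewrite /L; case: (i) => [[|[|[|]]]].
    rewrite !path_edge_cons path_edge_one orbF /same_pair.
    by do ?[case/orP]; case/andP=> /eqP-> /eqP->; rewrite // adj_sym.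
  have Mdisj k l : w \in nth [::] [:: A; rev B; [:: z]] k ->
      w \in nth [::] [:: A; rev B; [:: z]] l -> k = l.
    move: k l => [|[|[|k]]] [|[|[|l]]] //=; rewrite ?mem_rev ?inE ?nth_nil //.
    - by move=> wA /(AB' _ wA).
    - by move=> wA /eqP wz; rewrite -wz wA in zA.
    - by move=> wB wA; have := AB' _ wA wB.
    - by move=> wB /eqP wz; rewrite -wz wB in zB.
    - by move=> /eqP-> zA'; rewrite zA' in zA.
    - by move=> /eqP-> zB'; rewrite zB' in zB.
  move=> ij; rewrite !inL; case: (w \in [:: u; v]) => //= wi wj.
  by move: ij; rewrite -val_eqE /= (Mdisj _ _ wi wj) eqxx.
have d0 : d ord0 \in A.
  by have := dI ord0; rewrite interiorE /L /= inE mem_rcons inE => /and3P[/negPf-> /negPf->].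
have d1 : d (inord 1) \in B.
  have := dI (inord 1); rewrite interiorE /L /= inordK //= inE mem_rcons inE mem_rev.
  by case/and3P=> /negPf-> /negPf->.
have := adjd ord0 (inord 1); rewrite -val_eqE /= inordK // => /(_ isT).
rewrite adjut ?memt ?d0 ?d1 ?orbT // cycle_edge_split //.
(* An edge of the rim has both ends on one closed arc, whereas [d0] and [d1] put them inside
   different arcs. *)
case/orP=> /path_edge_mem[]; rewrite !inE !mem_rcons !inE ?mem_rev => m0 m1.
  case/or3P: m1 => [/eqP E|/eqP E|/AB'/(_ d1)//]; first by rewrite -E d1 in uB.
  by rewrite -E d1 in vB.
case/or3P: m0 => [/eqP E|/eqP E|/(AB' _ d0)//]; first by rewrite -E d0 in uA.
by rewrite -E d0 in vA.
Qed.

End ObstructionsNotThetaRing.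

(** Case analysis with canonical bound proofs, so that functions of the index given by [nth]
    compute. *)
Lemma ord3_ind (P : 'I_3 -> Prop) : P (@Ordinal 3 0 isT) -> P (@Ordinal 3 1 isT) ->
  P (@Ordinal 3 2 isT) -> forall i, P i.
Proof.
move=> P0 P1 P2 [[|[|[|k]]] ik] //.
- by rewrite (_ : Ordinal ik = @Ordinal 3 0 isT) //; apply/val_inj.
- by rewrite (_ : Ordinal ik = @Ordinal 3 1 isT) //; apply/val_inj.
- by rewrite (_ : Ordinal ik = @Ordinal 3 2 isT) //; apply/val_inj.
Qed.

Lemma ord3_others (i : 'I_3) : exists j k : 'I_3, [/\ i != j, i != k & j != k].
Proof.
by elim/ord3_ind: i;
  [exists (@Ordinal 3 1 isT), (@Ordinal 3 2 isT) | exists (@Ordinal 3 0 isT), (@Ordinal 3 2 isT)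
  | exists (@Ordinal 3 0 isT), (@Ordinal 3 1 isT)].
Qed.

Section PrismPyramidNotThetaRing.
Variable G : sgraph.
Implicit Types (x y u v a b : G) (P Q L c : seq G).

Lemma adj_neq u v : adj u v -> u != v.
Proof. by apply: contraTneq => ->; rewrite adj_irrefl. Qed.

Lemma is_path_rcons x y t L :
  is_path x y L -> adj y t -> t \notin L -> is_path x t (rcons L t).
Proof.
case: L => //= u p /and4P[-> /eqP<- pp /andP[up Up]] pt.
rewrite inE negb_or => /andP[tu tp].
by rewrite last_rcons eqxx rcons_path pp pt mem_rcons inE negb_or eq_sym tu up rcons_uniq tp Up.
Qed.

Lemma is_path_cons x y t L :
  is_path x y L -> adj t x -> t \notin L -> is_path t y (t :: L).
Proof. by case: L => //= u p /and4P[/eqP-> -> -> ->] -> ->; rewrite eqxx. Qed.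

(** The ends are [x 0] and [y 1], which lie on different paths and different triangles. The first
    two interiors are in [L 0] minus [x 0] and in [L 1] minus [y 1]; the only edges between [L 0]
    and [L 1] are [x 0]-[x 1] and [y 0]-[y 1], and each uses a removed vertex. *)
Lemma prism_not_theta_ring : prism G -> ~ theta_ring G.
Proof.
case=> x [y [L [[xx yy xy] pL LI _ [_ edges]]]] /theta_ringP tG.
have meet i j v : v \in L i -> v \in L j -> i = j.
  move=> vi vj; apply/eqP; apply: contraT => /LI/setP/(_ v).
  by rewrite !inE vi vj.
have xL i j : x i \in L j -> i = j.
  by apply: meet; have [] := is_path_ends (pL i).
have yL i j : y i \in L j -> i = j.
  by apply: meet; have [] := is_path_ends (pL i).
pose o1 : 'I_3 := @Ordinal 3 1 isT; pose o2 : 'I_3 := @Ordinal 3 2 isT.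
pose Q (i : 'I_3) := nth [::]
  [:: rcons (L ord0) (y o1); x ord0 :: L o1; x ord0 :: rcons (L o2) (y o1)] i.
have QE i v : v \in Q i -> v \notin [:: x ord0; y o1] -> v \in L i.
  rewrite !inE => vi /norP[/negPf vx /negPf vy]; move: vi.
  rewrite /Q; have [-> | [-> | ->]] : i = ord0 \/ i = o1 \/ i = o2.
  - by case: (i) => [[|[|[|]]]] // p; [left|right; left|right; right]; apply/val_inj.
  - by rewrite /= mem_rcons inE vy.
  - by rewrite /= inE vx.
  - by rewrite /= inE mem_rcons inE vx vy.
have [|d [dI /(_ ord0 o1 isT)/edges]] := tG (x ord0) (y o1) Q.
  split=> //.
  - apply/negP => /edges[[i /path_edge_mem[/xL <- /yL] //]|[i [j [_ E]]]|[i [j [E _]]]].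
      by have := xy j o1; rewrite E eqxx.
    by have := xy ord0 i; rewrite E eqxx.
  - case=> [[|[|[|]]]] // p; rewrite /Q /=.
    + by apply: is_path_rcons (pL _) (yy _ _ _) _ => //; apply/negP => /yL.
    + by apply: is_path_cons (pL _) (xx _ _ _) _ => //; apply/negP => /xL.
    + apply: is_path_cons (xx ord0 o2 isT) _.
        by apply: is_path_rcons (pL _) (yy _ _ _) _ => //; apply/negP => /yL.
      by rewrite mem_rcons inE negb_or xy; apply/negP => /xL.
  - move=> i j v ij /QE vi /QE vj; apply: contraT => vE.
    by rewrite (meet _ _ _ (vi vE) (vj vE)) eqxx in ij.
have dL i : [/\ d i != x ord0, d i != y o1 & d i \in L i].
  by have := dI i; rewrite interiorE => /and3P[dx dy /QE->]; rewrite // !inE negb_or dx.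
have [d0x _ d0L] := dL ord0; have [_ d1y d1L] := dL o1.
case=> [[i /path_edge_mem[d0 d1]]|[i [j [E _]]]|[i [j [_ E]]]].
- by have := meet _ _ _ d0L d0; rewrite -(meet _ _ _ d1L d1).
- by move: d0L d0x; rewrite E => /xL->; rewrite eqxx.
- by move: d1L d1y; rewrite E => /yL->; rewrite eqxx.
Qed.

(** The ends are the apex [w] and the foot [z b] of a path with more than one edge; the other two
    paths are prolonged to [z b] by a triangle edge. An edge between the interior of [P b] and that
    of another path would have to be a triangle edge at [z b], which is an end. *)
Lemma pyramid_not_theta_ring : pyramid G -> ~ theta_ring G.
Proof.
case=> w [z [P [zz pP PI sizes [_ edges]]]] /theta_ringP tG.
have meet i j v : v \in P i -> v \in P j -> v != w -> i = j.
  move=> vi vj vw; apply/eqP; apply: contraT => /PI[/setP/(_ v) + _].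
  by rewrite !inE vi vj (negPf vw).
have zP i : z i \in P i by have [] := is_path_ends (pP i).
have wP i : w \in P i by have [] := is_path_ends (pP i).
(* Otherwise [w] has three neighbours on the cycle formed by the two other paths. *)
have wz i : w != z i.
  have [j [k [ij ik jk]]] := ord3_others i.
  (* At most one path is a single edge, so one of the two others is not; its second vertex [a] is
     the third neighbour of [w]. *)
  wlog sj : j k ij ik jk / size (P j) <> 2.
    case: (size (P j) =P 2) => [Ej|nj] IH; last exact: (IH j k).
    apply: (IH k j) => //; first by rewrite eq_sym.
    by move=> Ek; rewrite (sizes _ _ Ej Ek) eqxx in jk.
  apply/eqP => Ew; have wzj := zz _ _ ij; have wzk := zz _ _ ik; rewrite -Ew in wzj wzk.
  have [A EP] := is_path_split (adj_neq wzj) (pP j).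
  case: A EP => [|a A] EP; first by rewrite EP in sj.
  have UP := is_path_uniq (pP j); have wa : adj w a.
    by apply: (is_path_adj (pP j)); rewrite EP /= path_edge_cons /same_pair !eqxx.
  have [_ cyc] := PI _ _ jk.
  have inS v : (v \in [set v in P j] :|: [set v in P k]) = (v \in P j) || (v \in P k).
    by rewrite !inE.
  have [|b [c [_ _ _ wE]]] := cycle_graph_induced_degree cyc (x := w).
    by rewrite inS wP.
  have aP : a \in P j by rewrite EP !inE eqxx orbT.
  have azj : a != z j.
    by move: UP; rewrite EP /= mem_rcons inE negb_or; case/and3P=> _ /andP[].
  have azk : a != z k.
    apply: contraNneq jk => Ea; apply/eqP; apply: meet aP _ _; first by rewrite Ea.
    by rewrite eq_sym (adj_neq wa).
  have zjk := adj_neq (zz _ _ jk).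
  have := wE a; rewrite inS aP wa => /(_ isT).
  have := wE (z j); rewrite inS zP wzj => /(_ isT).
  have := wE (z k); rewrite inS zP wzk orbT => /(_ isT).
  move=> /esym/orP[]/eqP Ek /esym/orP[]/eqP Ej /esym/orP[]/eqP Ea;
    by rewrite Ek Ej Ea ?eqxx in azj azk zjk.
have [b sb] : exists b : 'I_3, size (P b) <> 2.
  have [j [k [ij _ _]]] := ord3_others ord0.
  case: (size (P ord0) =P 2) => [E0|n0]; last by exists ord0.
  by exists j => Ej; rewrite (sizes _ _ E0 Ej) eqxx in ij.
have zbP i : i != b -> z b \notin P i.
  by apply: contraNN => zbi; rewrite (meet _ _ _ zbi (zP b)) // eq_sym wz.
pose Q i := if i == b then P b else rcons (P i) (z b).
have QE i v : v \in Q i -> v != z b -> v \in P i.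
  by rewrite /Q; case: eqP => [->//|_]; rewrite mem_rcons inE => /orP[->|].
have [j [k [bj _ _]]] := ord3_others b.
have [|d [dI /(_ b j bj)/edges]] := tG w (z b) Q.
  split=> //.
  - apply/negP => /edges[[i wzi]|[i [_ [Ew _]]]]; last by have := wz i; rewrite -Ew eqxx.
    have /path_edge_mem[_ zbi] := wzi.
    have ib : i = b by apply: meet zbi (zP b) _; rewrite eq_sym.
    have := is_path_uniq (pP b); have [[|a A] EP] := is_path_split (wz b) (pP b).
      by rewrite EP in sb.
    rewrite ib EP in wzi; rewrite EP /= => /and3P[_ + _].
    move: wzi; rewrite path_edge_head -?EP ?(is_path_uniq (pP b)) //= => /eqP->.
    by rewrite mem_rcons mem_head.
  - move=> i; rewrite /Q; case: eqP => [_|/eqP ib]; first exact: pP.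
    by apply: is_path_rcons (pP i) (zz _ _ ib) (zbP _ ib).
  - move=> i l v il /QE vi /QE vl; rewrite !inE orbC; case: eqP vi vl => //= /eqP vz vi vl.
    by apply: contraT => vw; rewrite (meet _ _ _ (vi isT) (vl isT) vw) eqxx in il.
have dP i : [/\ d i != w, d i != z b & d i \in P i].
  by have := dI i; rewrite interiorE => /and3P[dw dz /QE->].
have [dbw dbz dbP] := dP b; have [djw _ djP] := dP j.
case=> [[i /path_edge_mem[dbi dji]]|[i [l [E _]]]].
  by rewrite (meet _ _ _ dbP dbi dbw) (meet _ _ _ djP dji djw) eqxx in bj.
have ib : i = b by apply: meet (zP i) _ _; rewrite -E.
by rewrite E ib eqxx in dbz.
Qed.

End PrismPyramidNotThetaRing.

Lemma has_induced_embedding (G H : sgraph) : has_induced G H ->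
  exists f : H -> G, embedding f.
Proof.
case=> S [f [g fK gK] fE]; exists (val \o g); split=> [u v /val_inj|u v] /=.
  exact: (can_inj gK).
by rewrite -(gK u) -(gK v) fE !gK.
Qed.

Definition obstruction (H : sgraph) :=
  [\/ theta_partial_wheel H, prism H, pyramid H | theta H].

Definition obstruction_free (G : sgraph) :=
  forall H : sgraph, obstruction H -> ~ has_induced G H.

Lemma theta_ring_obstruction_free G : theta_ring G -> obstruction_free G.
Proof.
move=> tG H HH /has_induced_embedding[f fE].
have tH := theta_ring_embedding fE tG.
case: HH => H_; first exact: theta_partial_wheel_not_theta_ring tH.
- exact: prism_not_theta_ring tH.
- exact: pyramid_not_theta_ring tH.
- exact: theta_not_theta_ring tH.
Qed.

(** * Clique-sums of theta-rings *)

Section CliqueSumThetaRing.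
Variable G : sgraph.
Implicit Types (x y u v z : G) (p L : seq G) (A B : {set G}).

Definition clique_separation A B :=
  (forall u v, adj u v -> (u \in A) && (v \in A) || (u \in B) && (v \in B)) /\
  (forall u v, u \in A :&: B -> v \in A :&: B -> u != v -> adj u v).

Lemma clique_separationC A B : clique_separation A B -> clique_separation B A.
Proof. by case=> eAB cAB; split=> u v; rewrite 1?orbC ?(setIC B); auto. Qed.

(** Stated for paths of [G] that stay in [A], so that a path is filtered in place instead of being
    moved to an induced subgraph. *)
Definition theta_ring_on A := forall x y (L : 'I_3 -> seq G), theta_paths x y L ->
  (forall i, {subset L i <= A}) ->
  exists d : 'I_3 -> G, (forall i, d i \in interior x y (L i)) /\
    forall i j, i != j -> adj (d i) (d j).

(** No edge joins [A] minus [B] to [B] minus [A], so the walk stays in [A] until it first enters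
    [B]. *)
Lemma separation_crossing A B x p : clique_separation A B ->
  path (@adj G) x p -> x \in A -> last x p \in B ->
  exists2 v, v \in x :: p & v \in A :&: B.
Proof.
case=> eAB _; elim: p x => [|y p IH] x /=.
  by move=> _ xA xB; exists x; rewrite ?mem_head // inE xA.
case/andP=> xy yp xA lB; case xB: (x \in B).
  by exists x; rewrite ?mem_head // inE xA.
have yA : y \in A by have := eAB _ _ xy; rewrite xB orbF => /andP[].
have [v vp vAB] := IH _ yp yA lB.
by exists v; rewrite // inE vp orbT.
Qed.

(* [u] is the last vertex kept so far and [z] the current one; an excursion out
   of [A] leaves and returns through the clique [A :&: B]. *)
Lemma filter_path A B p z u : clique_separation A B ->
  path (@adj G) z p -> uniq (z :: p) -> last z p \in A ->
  (u = z /\ z \in A) \/ [/\ z \notin A, u \in A :&: B & u \notin p] ->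
  path (@adj G) u (filter [in A] p) /\ last u (filter [in A] p) = last z p.
Proof.
case=> eAB cAB; elim: p z u => [|y p IH] z u /=.
  by move=> _ _ zA [[->]//|[]]; rewrite zA.
case/andP=> zy yp /and3P[znp ynp Up] lA.
have Uyp : uniq (y :: p) by rewrite /= ynp.
move: znp; rewrite inE negb_or => /andP[zy' zp] uz.
have := eAB _ _ zy; case: ifP => [yA|nyA].
  move=> eyz; have [pf lf] := IH y y yp Uyp lA (or_introl (conj erefl yA)).
  rewrite /= pf lf andbT; split=> //; case: uz => [[->//]|[zA uAB uyp]].
  apply: cAB => //; first by move: eyz; rewrite (negPf zA) !inE yA => /andP[].
  by move: uyp; rewrite inE negb_or => /andP[].
rewrite andbF => /andP[zB yB]; apply: IH => //; right; rewrite nyA.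
case: uz => [[-> zA]|[_ uAB]]; first by split=> //; rewrite inE zA.
by rewrite inE negb_or => /andP[_ up].
Qed.

Lemma is_path_filter A B x y L : clique_separation A B ->
  is_path x y L -> x \in A -> y \in A -> is_path x y (filter [in A] L).
Proof.
move=> AB; case: L => // z p /and4P[/eqP-> /eqP <- pp Up] xA lA /=.
have [|pf lf] := filter_path AB pp Up lA (u := x); first by left.
rewrite xA /= eqxx pf lf eqxx mem_filter negb_and /=.
by case/andP: Up => -> Up; rewrite orbT filter_uniq.
Qed.

(** Filtering keeps the ends and only shrinks the interiors, so a triangle transversal to the
    shortened paths is transversal to the original ones. *)
Lemma theta_ring_on_shortcut A B x y (L : 'I_3 -> seq G) : clique_separation A B ->
  theta_ring_on A -> theta_paths x y L -> x \in A -> y \in A ->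
  exists d : 'I_3 -> G, (forall i, d i \in interior x y (L i)) /\
    forall i j, i != j -> adj (d i) (d j).
Proof.
move=> AB tA [xy nxy pL IL] xA yA.
have [||d [dI adjd]] := tA x y (fun i => filter [in A] (L i)).
- split=> // [i|i j v ij]; first exact: is_path_filter AB (pL i) xA yA.
  by rewrite !mem_filter => /andP[_ vi] /andP[_]; apply: IL vi.
- by move=> i v; rewrite mem_filter => /andP[].
exists d; split=> // i; have := dI i; rewrite !interiorE mem_filter.
by case/and4P=> -> -> _ ->.
Qed.

(** Each path crosses [A :&: B], at an inner vertex because neither end is in it. Paths share only
    their ends, so the three crossings are distinct vertices of a clique. *)
Lemma theta_paths_crossing A B x y (L : 'I_3 -> seq G) : clique_separation A B ->
  theta_paths x y L -> x \in A :\: B -> y \in B :\: A ->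
  exists d : 'I_3 -> G, (forall i, d i \in interior x y (L i)) /\
    forall i j, i != j -> adj (d i) (d j).
Proof.
move=> AB [_ _ pL IL] /setDP[xA xB] /setDP[yB yA].
have [|d dP] := @fin_all_exists _ _ (fun i v => (v \in L i) && (v \in A :&: B)).
  move=> i; case: (L i) (pL i) => //= z p /and4P[/eqP-> /eqP yE pp _].
  rewrite -yE in yB; have [v vp vAB] := separation_crossing AB pp xA yB.
  by exists v; rewrite vAB andbT.
have dI i : d i \in interior x y (L i).
  have /and3P[dL dA dB] : [&& d i \in L i, d i \in A & d i \in B].
    by have := dP i; rewrite inE.
  rewrite interiorE dL andbT; apply/andP; split.
    by apply: contraNneq xB => <-.
  by apply: contraNneq yA => <-.
exists d; split=> // i j ij; case/andP: (dP i) => di dAB; case/andP: (dP j) => dj dAB'.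
apply: AB.2 => //; apply/negP => /eqP Ed; have := dI j.
have := IL i j (d j) ij; rewrite -{1}Ed di dj interiorE !inE => /(_ isT isT).
by case/orP=> ->; rewrite ?andbF.
Qed.

Lemma theta_ring_separation A B : clique_separation A B -> A :|: B = setT ->
  theta_ring_on A -> theta_ring_on B -> theta_ring G.
Proof.
move=> AB ABT tA tB; apply/theta_ringP=> x y L tL.
have inAB v : (v \in A) || (v \in B) by rewrite -in_setU ABT inE.
have [xA|xA] := boolP (x \in A); have [yA|yA] := boolP (y \in A).
- exact: theta_ring_on_shortcut AB tA tL xA yA.
- have [xB|xB] := boolP (x \in B).
    have := inAB y; rewrite (negPf yA) => yB.
    exact: theta_ring_on_shortcut (clique_separationC AB) tB tL xB yB.
  have yB : y \in B by have := inAB y; rewrite (negPf yA).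
  by apply: theta_paths_crossing AB tL _ _; rewrite inE ?xA ?yA ?xB ?yB.
- have [yB|yB] := boolP (y \in B).
    have := inAB x; rewrite (negPf xA) => xB.
    exact: theta_ring_on_shortcut (clique_separationC AB) tB tL xB yB.
  have xB : x \in B by have := inAB x; rewrite (negPf xA).
  by apply: theta_paths_crossing (clique_separationC AB) tL _ _; rewrite inE ?xA ?yA ?xB ?yB.
have xB : x \in B by have := inAB x; rewrite (negPf xA).
have yB : y \in B by have := inAB y; rewrite (negPf yA).
exact: theta_ring_on_shortcut (clique_separationC AB) tB tL xB yB.
Qed.

End CliqueSumThetaRing.

(** * Clique-sums as separations, and the two base families *)

Lemma image_edgeP (H G : sgraph) (f : H -> G) u v :
  reflect (exists a b, [/\ f a = u, f b = v & adj a b]) (image_edge f u v).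
Proof.
apply: (iffP existsP) => [[a /existsP[b /and3P[/eqP <- /eqP <- ab]]]|].
  by exists a, b.
by case=> a [b [<- <- ab]]; exists a; apply/existsP; exists b; rewrite !eqxx.
Qed.

(** An edge of one summand between vertices of the other lies in the common clique, where both
    summands have every edge; hence each summand is induced. *)
Lemma clique_sum_separation k (G1 G2 G : sgraph) : clique_sum k G1 G2 G ->
  exists (f1 : G1 -> G) (f2 : G2 -> G),
    [/\ embedding f1, embedding f2,
        clique_separation (f1 @: [set: G1]) (f2 @: [set: G2])
      & f1 @: [set: G1] :|: f2 @: [set: G2] = [set: G]].
Proof.
case=> f1 [f2 [[inj1 inj2] cover edges _ cK]]; exists f1, f2.
have E1 u v : image_edge f1 u v -> (u \in f1 @: [set: G1]) && (v \in f1 @: [set: G1]).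
  by case/image_edgeP=> a [b [<- <- _]]; rewrite !imset_f ?inE.
have E2 u v : image_edge f2 u v -> (u \in f2 @: [set: G2]) && (v \in f2 @: [set: G2]).
  by case/image_edgeP=> a [b [<- <- _]]; rewrite !imset_f ?inE.
have emb (H : sgraph) (f : H -> G) : injective f ->
    (forall a b, adj (f a) (f b) -> image_edge f (f a) (f b)) ->
    (forall a b, adj a b -> adj (f a) (f b)) -> embedding f.
  move=> f_inj fE Ef; split=> // a b; apply/idP/idP=> [/fE|]; last exact: Ef.
  by case/image_edgeP=> a' [b' [/f_inj-> /f_inj->]].
split=> //.
- apply: emb => // a b.
    move=> ab; have := ab; rewrite edges => /orP[//|/E2/andP[a2 b2]].
    suff /andP[] : image_edge f1 (f1 a) (f1 b) && image_edge f2 (f1 a) (f1 b) by [].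
    by apply: cK (adj_neq ab); rewrite inE ?a2 ?b2 imset_f.
  by move=> ab; rewrite edges; apply/orP; left; apply/image_edgeP; exists a, b.
- apply: emb => // a b.
    move=> ab; have := ab; rewrite edges => /orP[/E1/andP[a1 b1]|//].
    suff /andP[] : image_edge f1 (f2 a) (f2 b) && image_edge f2 (f2 a) (f2 b) by [].
    by apply: cK (adj_neq ab); rewrite inE ?a1 ?b1 imset_f.
  by move=> ab; rewrite edges; apply/orP; right; apply/image_edgeP; exists a, b.
- split=> u v; first by rewrite edges => /orP[/E1|/E2] ->; rewrite ?orbT.
  by move=> uK vK uv; rewrite edges; case/andP: (cK _ _ uK vK uv) => ->.
Qed.

Lemma separation_clique_sum (G : sgraph) (A B : {set G}) :
  clique_separation A B -> A :|: B = setT ->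
  clique_sum #|A :&: B| (induced A) (induced B) G.
Proof.
case=> eAB cAB ABT; exists val, val.
have imE (S : {set G}) : val @: [set: induced S] = S.
  apply/setP=> v; apply/imsetP/idP=> [[x _ ->]|vS]; first exact: valP.
  by have [x <-] := induced_preimage vS; exists x.
rewrite !imE; have edge (S : {set G}) u v : u \in S -> v \in S -> adj u v ->
    image_edge (val : induced S -> G) u v.
  move=> /induced_preimage[a <-] /induced_preimage[b <-] ab.
  by apply/image_edgeP; exists a, b.
split=> //; first by split; apply: val_inj.
  move=> u v; apply/idP/orP=> [uv|[]].
  - by case/orP: (eAB _ _ uv) => /andP[uS vS]; [left|right]; apply: edge.
  - by case/image_edgeP=> a [b [<- <-]].
  - by case/image_edgeP=> a [b [<- <-]].
move=> u v uK vK uv; have uv' := cAB _ _ uK vK uv.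
by move: uK vK; rewrite !inE => /andP[uA uB] /andP[vA vB]; rewrite !edge.
Qed.

Lemma theta_ring_on_image (H G : sgraph) (f : H -> G) : embedding f ->
  theta_ring H -> theta_ring_on (f @: [set: H]).
Proof.
move=> fE /theta_ringP tH x y L [xy nxy pL IL] LS; have [f_inj f_adj] := fE.
have [|L' LE] := @fin_all_exists _ _ (fun i s => L i = map f s).
  by move=> i; apply: seq_preimage => v /LS/imsetP[w _ ->]; exists w.
have [x' Ex] : exists x', x = f x'.
  have [/LS/imsetP[x' _ ->] _] := is_path_ends (pL ord0); by exists x'.
have [y' Ey] : exists y', y = f y'.
  have [_ /LS/imsetP[y' _ ->]] := is_path_ends (pL ord0); by exists y'.
have [|d [dI adjd]] := tH x' y' L'.
  split=> [|||i j v ij vi vj].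
  - by rewrite -(inj_eq f_inj) -Ex -Ey.
  - by rewrite -f_adj -Ex -Ey.
  - by move=> i; rewrite -(is_path_map _ _ _ fE) -Ex -Ey -LE.
  have := IL _ _ (f v) ij; rewrite !LE !mem_map // => /(_ vi vj).
  by rewrite Ex Ey !inE !(inj_eq f_inj).
exists (f \o d); split=> [i|i j ij]; last by rewrite /= f_adj adjd.
by have := dI i; rewrite Ex Ey !interiorE LE /= mem_map // !(inj_eq f_inj).
Qed.

Lemma theta_ring_complete G : complete_graph G -> theta_ring G.
Proof.
move=> /forall_inP cG; apply/theta_ringP=> x y L [xy nxy _ _].
have /forall_inP/(_ y (in_setT _))/implyP/(_ xy) := cG x (in_setT _).
by rewrite (negPf nxy).
Qed.

(** Vacuous: the three paths leave [x] through distinct neighbours, but [x] has only two. *)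
Lemma theta_ring_cycle G : cycle_graph G -> theta_ring G.
Proof.
move=> cG; apply/theta_ringP=> x y L [xy nxy pL IL].
have [a [b [_ xab]]] := cycle_graph_degree x cG.
have [|e eP] := @fin_all_exists _ _ (fun i v => (v \in L i) && adj x v).
  move=> i; have [A EL] := is_path_split xy (pL i).
  (* The default [y] is the second vertex of a path without inner vertices, a case that [nxy] rules
     out below. *)
  exists (head y A); have xA : path_edge (L i) x (head y A).
    have U := is_path_uniq (pL i); rewrite EL in U *.
    by rewrite path_edge_head //; case: (A) => [|? ?] /=; rewrite eqxx.
  by rewrite (is_path_adj (pL i) xA) (path_edge_mem xA).2.
have e_inj i j : i != j -> e i != e j.
  move=> ij; case/andP: (eP i) => ei xi; case/andP: (eP j) => ej xj.
  apply/eqP => Ee; have := IL _ _ (e j) ij; rewrite -{1}Ee ei ej => /(_ isT isT).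
  rewrite !inE => /orP[]/eqP Ej; last by rewrite -Ej xj in nxy.
  by rewrite Ej adj_irrefl in xj.
have [j [k [ij ik jk]]] := ord3_others ord0.
have eab i : (e i == a) || (e i == b) by rewrite -xab; case/andP: (eP i).
have := e_inj _ _ ij; have := e_inj _ _ ik; have := e_inj _ _ jk.
by case/orP: (eab ord0) => /eqP->; case/orP: (eab j) => /eqP->; case/orP: (eab k) => /eqP->;
   rewrite eqxx.
Qed.

Lemma constructible_theta_ring sizes G :
  constructible sizes (fun H => complete_graph H \/ cycle_graph H) G -> theta_ring G.
Proof.
elim=> {G} [G [/theta_ring_complete|/theta_ring_cycle] //|k G1 G2 G _ _ t1 _ t2].
case/clique_sum_separation=> f1 [f2 [e1 e2 sep cover]].
by apply: theta_ring_separation sep cover _ _; apply: theta_ring_on_image.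
Qed.

(** * Shortest links and clique separators *)

Definition adj_in (G : sgraph) (A : pred G) : rel G :=
  fun u v => [&& adj u v, A u & A v].

Lemma adj_in_connect_sym (G : sgraph) (A : pred G) : connect_sym (adj_in A).
Proof.
by apply: sym_connect_sym => u v; rewrite /adj_in adj_sym [A u && _]andbC.
Qed.

Lemma adj_in_walk (G : sgraph) (A : pred G) b c : A b -> connect (adj_in A) b c ->
  exists s, [/\ path (@adj G) b s, last b s = c, uniq (b :: s) & all A (b :: s)].
Proof.
move=> Ab /connectP[s0 ps0 ->]; case/shortenP: ps0 => s ps Us _.
exists s; split=> //; first by apply: sub_path ps => u v /and3P[].
rewrite /= Ab /=; by elim: s b {Ab Us} ps => //= v s IH b /andP[/and3P[_ _ ->] /IH->].
Qed.

Section ShortestLink.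
Variables (G : sgraph) (D : pred G) (bad : rel G).
Implicit Types (u v w z a b c : G) (p s : seq G).

(* The adjacency to [head u p] forces [p] to be nonempty, since the default is [u]. *)
Definition linked p u v :=
  [&& bad u v, sorted (@adj G) p, all (predC D) p, adj u (head u p) & adj v (last v p)].

Lemma sorted_walk p b c : sorted (@adj G) p -> b \in p -> c \in p ->
  exists s, [/\ path (@adj G) b s, last b s = c, uniq (b :: s) & {subset b :: s <= p}].
Proof.
case: p => // a p ap bp cp; pose A := [in a :: p].
have pe : path (adj_in A) a p.
  apply: (sub_in_path (P := A)) ap; last by apply/allP.
  by move=> u v uA vA uv; apply/and3P.
have ca := path_connect pe.
have [|s [ps ls Us /allP As]] := @adj_in_walk G A b c bp; last by exists s.
by apply: connect_trans (ca _ cp); rewrite adj_in_connect_sym ca.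
Qed.

(** The last two clauses record minimality for the link without its last vertex and without its
    first one: no bad pair, be it [u], [v] or another, attaches within either. *)
Definition shortest_link a s u v :=
  [/\ linked (a :: s) u v, uniq (a :: s),
      {in a :: s &, forall b c, adj b c = path_edge (a :: s) b c},
      {in belast a s &, forall b c w z, bad w z -> adj w b -> ~~ adj z c}
    & {in s &, forall b c w z, bad w z -> adj w b -> ~~ adj z c}].

Lemma exists_shortest_link p0 u0 v0 : linked p0 u0 v0 ->
  exists a s u v, shortest_link a s u v.
Proof.
(* Tuples make [P] boolean; quantifying over [u] and [v] makes the minimum range over all bad
   pairs. *)
pose P n := [exists p : n.-tuple G, exists u, exists v, uniq p && linked p u v].
have PI p u v : uniq p -> linked p u v -> P (size p).
  move=> Up pl; apply/existsP; exists (in_tuple p).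
  by apply/existsP; exists u; apply/existsP; exists v; rewrite Up.
(* A bad pair attached anywhere on a walk outside [D] has a link no longer than that walk. *)
have walkP p : sorted (@adj G) p -> all (predC D) p ->
    forall b c w z, b \in p -> c \in p -> bad w z -> adj w b -> adj z c ->
    exists2 n, P n & n <= size p.
  move=> sp Dp b c w z bp cp wz wb zc.
  have [s [ps ls Us ss]] := sorted_walk sp bp cp.
  exists (size (b :: s)); last exact: uniq_leq_size.
  apply: (PI _ w z) => //; apply/and5P; split=> //; last by rewrite /= ls.
  by apply/allP => t /ss; apply: (allP Dp).
move=> l0; have exP : exists n, P n.
  have /and5P[b0 s0 D0 u0h v0l] := l0; case: p0 => [|a s] in s0 D0 u0h v0l l0 *.
    by rewrite adj_irrefl in u0h.
  have [n Pn _] := walkP _ s0 D0 a (last a s) u0 v0 (mem_head _ _) (mem_last _ _) b0 u0h v0l.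
  by exists n.
case: (ex_minnP exP) => m /existsP[[p /= /eqP Ep] /existsP[u /existsP[v /andP[Up pl]]]] mmin {exP}.
have /and5P[buv sp Dp up vp] := pl.
case: p => [|a s] in Ep Up pl sp Dp up vp *; first by rewrite adj_irrefl in up.
exists a, s, u, v.
have short q w z b c : {subset q <= a :: s} -> sorted (@adj G) q -> size q < m ->
    b \in q -> c \in q -> bad w z -> adj w b -> ~~ adj z c.
  move=> qs sq mq bq cq wz wb; apply/negP => zc.
  have Dq : all (predC D) q by apply/allP => t /qs; apply: (allP Dp).
  have [n Pn nq] := walkP _ sq Dq _ _ _ _ bq cq wz wb zc.
  by have := leq_ltn_trans (leq_trans (mmin _ Pn) nq) mq; rewrite ltnn.
(* Skipping [p2] along the chord keeps the first and last vertices, hence the attachments, and would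
   give a shorter link. *)
have chord p1 b p2 c p3 : a :: s = p1 ++ b :: p2 ++ c :: p3 -> adj b c -> p2 = [::].
  move=> E bc; case: p2 => // t p2 in E *.
  have sub : subseq (p1 ++ b :: c :: p3) (a :: s).
    rewrite E; apply: (cat_subseq (subseq_refl p1)).
    exact: (cat_subseq (subseq_refl [:: b]) (suffix_subseq (t :: p2) (c :: p3))).
  have l' : linked (p1 ++ b :: c :: p3) u v.
    apply/and5P; split; first by [].
    - apply/sorted_adj => w z; have := (sorted_adj (a :: s)).1 sp w z.
      rewrite E !path_edge_split path_edge_cons.
      rewrite -cat_cons (path_edge_split (b :: _)).
      case: (path_edge (rcons p1 b) w z) => //= H; case/orP=> [|wz].
        by case/orP=> /andP[/eqP-> /eqP->] //; rewrite adj_sym.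
      by apply: H; rewrite wz orbT.
    - by apply/allP => w /(mem_subseq sub); apply: (allP Dp).
    - by move: up; rewrite E; case: (p1).
    - by move: vp; rewrite E !last_cat /= last_cat.
  have := mmin _ (PI _ _ _ (subseq_uniq sub Up) l').
  rewrite -Ep E !size_cat /= size_cat /=.
  by rewrite leq_add2l !addnS !ltnS leqNgt ltnS leq_addl.
split=> //.
- move=> b c bp cp; apply/idP/idP; last exact: (sorted_adj (a :: s)).1.
  have path_edgeI p1 w z p3 : a :: s = p1 ++ w :: z :: p3 -> path_edge (a :: s) w z.
    by move=> ->; rewrite path_edge_split path_edge_cons /same_pair !eqxx orbT.
  have key w z p1 p2 : a :: s = p1 ++ w :: p2 -> z \in p2 -> adj w z -> path_edge (a :: s) w z.
    move=> E zp2; case/splitPr: zp2 E => p3 p4 E wz.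
    have E0 := chord _ _ _ _ _ E wz; rewrite E0 in E; exact: path_edgeI E.
  move=> bc; have Ebc := adj_neq bc.
  have [p1 [p2 E]] : exists p1 p2, a :: s = p1 ++ b :: p2.
    by case/splitPr: bp => p1 p2; exists p1, p2.
  move: cp; rewrite {1}E mem_cat inE eq_sym (negPf Ebc) /=.
  case/orP=> [cp1|cp2]; last exact: key E cp2 bc.
  case/splitPr: cp1 E => p3 p4; rewrite -catA /= => E; rewrite path_edgeC.
  by apply: key E _ _; rewrite ?mem_cat ?mem_head ?orbT // adj_sym.
- move=> b c bs cs w z; apply: short bs cs; rewrite ?size_belast -?Ep //.
    by move=> t ts; rewrite lastI mem_rcons inE ts orbT.
  by move: sp; rewrite lastI -cats1 => /cat_sorted2[].
- move=> b c bs cs w z; apply: short bs cs; rewrite -?Ep //.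
    by move=> t ts; rewrite inE ts orbT.
  by move: sp => /= /path_sorted.
Qed.

End ShortestLink.

Section Components.
Variable G : sgraph.
Implicit Types (u v w x y : G) (D : pred G) (H : {set G}).

Definition component D y : {set G} := [set v | connect (adj_in (predC D)) y v].

Definition neighbourhood H : {set G} :=
  [set k | (k \notin H) && [exists h in H, adj k h]].

Lemma neighbourhoodP H k :
  reflect (k \notin H /\ exists2 h, h \in H & adj k h) (k \in neighbourhood H).
Proof.
rewrite inE; apply: (iffP andP) => [[kH /exists_inP[h hH kh]]|[kH [h hH kh]]].
  by split=> //; exists h.
by split=> //; apply/exists_inP; exists h.
Qed.

Lemma component_avoids D y v : ~~ D y -> v \in component D y -> ~~ D v.
Proof.
move=> yD; rewrite inE => /(adj_in_walk (A := predC D) yD)[s [_ <- _ /allP Ds]].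
exact: Ds (mem_last _ _).
Qed.

Lemma neighbourhood_component D y k : ~~ D y -> k \in neighbourhood (component D y) -> D k.
Proof.
move=> yD /neighbourhoodP[kH [h hH kh]]; apply: contraNT kH => kD.
have hD := component_avoids yD hH.
move: hH; rewrite !inE => /connect_trans; apply; apply: connect1.
by rewrite /adj_in adj_sym kh /= hD kD.
Qed.

Lemma neighbourhood_linked D (bad : rel G) y u v : ~~ D y ->
  u \in neighbourhood (component D y) -> v \in neighbourhood (component D y) ->
  bad u v -> exists p, linked D bad p u v.
Proof.
move=> yD /neighbourhoodP[_ [h hH uh]] /neighbourhoodP[_ [k kH vk]] uv.
have hk : connect (adj_in (predC D)) h k.
  move: hH kH; rewrite !inE => yh yk; apply: connect_trans yk.
  by rewrite adj_in_connect_sym.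
have [s [ps ls _ Ds]] := adj_in_walk (component_avoids yD hH : predC D h) hk.
by exists (h :: s); rewrite /linked uv Ds uh /= ps ls.
Qed.

(** [G] is the clique-sum, in the neighbourhood of [H], of [H] with its neighbourhood and of the
    complement of [H]. The first two hypotheses make both parts proper, as the induction
    requires. *)
Lemma constructible_neighbourhood (sizes : pred nat) (F : sgraph -> Prop) H :
  H != set0 -> H :|: neighbourhood H != setT -> sizes #|neighbourhood H| ->
  {in neighbourhood H &, forall u v, u != v -> adj u v} ->
  (forall S : {set G}, #|S| < #|G| -> constructible sizes F (induced S)) ->
  constructible sizes F G.
Proof.
move=> H0 HT sK cK IH; set K := neighbourhood H in HT sK cK.
have EK : (H :|: K) :&: ~: H = K.
  apply/setP=> v; rewrite !inE; case: (v \in H) => //=.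
  by rewrite andbT.
have cover : (H :|: K) :|: ~: H = setT.
  by apply/setP=> v; rewrite !inE; case: (v \in H); rewrite ?orbT.
apply: (Constr_sum (k := #|K|) (G1 := induced (H :|: K)) (G2 := induced (~: H))) => //.
- by apply: IH; rewrite -cardsT proper_card // properT.
- apply: IH; rewrite -cardsT proper_card // properT.
  by apply: contraNneq H0 => E; rewrite -[H]setCK E setCT.
suff /separation_clique_sum/(_ cover) : clique_separation (H :|: K) (~: H) by rewrite EK.
split; last by rewrite EK.
have inK u v : adj u v -> u \in H -> v \in H :|: K.
  move=> uv uH; rewrite inE; case vH: (v \in H) => //=.
  by apply/neighbourhoodP; rewrite vH; split=> //; exists u; rewrite // adj_sym.
move=> u v uv; rewrite !(in_setC); case uH: (u \in H).
  by rewrite (inK _ _ uv uH) inE uH.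
case vH: (v \in H); last by rewrite orbT.
by rewrite (inK v u) ?inE ?vH // adj_sym.
Qed.

End Components.

(** Another neighbour of [u] on the link would, with the last vertex, link [u] to [v] without using
    [a]; symmetrically for [v]. *)
Lemma shortest_link_ends (G : sgraph) (D : pred G) (bad : rel G) a s u v :
  shortest_link D bad a s u v ->
  {in a :: s, forall b, adj u b -> b = a} /\ {in a :: s, forall b, adj v b -> b = last a s}.
Proof.
move=> [/and5P[uv _ _ /= ua vl] _ _ Hbelast Hs]; split=> b.
  rewrite inE => /predU1P[//|bs] ub; case/lastP: s bs vl Hs {Hbelast} => // s l bs.
  rewrite last_rcons => vl Hs; have := Hs b l bs _ u v uv ub.
  by rewrite mem_rcons mem_head vl => /(_ isT).
rewrite lastI mem_rcons inE => /predU1P[//|bs] vb.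
have as_ : a \in belast a s by case: s bs {vl Hbelast Hs} => //= c s; rewrite mem_head.
by have := Hbelast a b as_ bs u v uv ua; rewrite vb.
Qed.

Lemma chordal_induced (G : sgraph) (S : {set G}) : chordal G -> chordal (induced S).
Proof.
move=> chG c cc c4; have vE := induced_embedding S.
have := chG (map val c); rewrite (cycle_seq_map c vE) size_map => /(_ cc c4).
case=> _ [_ [/mapP[u uc ->] /mapP[v vc ->] uv]].
have /and3P[_ _ Uc] := cc; rewrite (cycle_edge_map _ _ vE.1 Uc) => ncuv.
by exists u, v.
Qed.

(* The neighbourhood of a component avoiding [x] and its neighbours is a clique: a
   shortest link between two nonadjacent vertices of it would close up with [x]
   into a chordless cycle. *)
Lemma chordal_constructible (F : sgraph -> Prop) G :
  (forall H, complete_graph H -> F H) -> chordal G -> constructible predT F G.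
Proof.
move=> FK; move: {2}#|G|.+1 (ltnSn #|G|) => n.
elim: n => // n IHn in G *; rewrite ltnS => Gn chG.
have IH (S : {set G}) : #|S| < #|G| -> constructible predT F (induced S).
  move=> SG; apply: IHn; last exact: chordal_induced.
  by rewrite card_induced (leq_trans SG).
have [cG|] := boolP (complete_graph G); first exact: Constr_base (FK _ cG).
rewrite negb_forall_in => /exists_inP[x _]; rewrite negb_forall_in => /exists_inP[y _].
rewrite negb_imply => /andP[xy nxy].
(* With the whole closed neighbourhood of [x] removed, [x] is neither in the component of [y] nor
   next to it. *)
pose D v := (v == x) || adj x v.
have yD : ~~ D y by rewrite negb_or eq_sym xy.
apply: (constructible_neighbourhood (H := component D y)) => //.
- by apply/set0Pn; exists y; rewrite inE.
- suff : x \notin component D y :|: neighbourhood (component D y).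
    by apply: contraNneq => ->; rewrite inE.
  rewrite inE negb_or; apply/andP; split.
    by apply/negP => /(component_avoids yD); rewrite /D eqxx.
  apply/negP => /neighbourhoodP[_ [h /(component_avoids yD) + xh]].
  by rewrite /D xh orbT.
move=> u0 v0 u0K v0K uv0; apply: contraT => nuv0.
(* The shortest link may join a pair other than [u0], [v0]; adjacency to [x] is built into [bad] so
   that it still closes up through [x]. *)
pose bad u v := [&& adj x u, adj x v, u != v & ~~ adj u v].
have adjx k : k \in neighbourhood (component D y) -> adj x k.
  move=> kK; case/orP: (neighbourhood_component yD kK) => // /eqP Ek.
  have /neighbourhoodP[_ [h /(component_avoids yD)]] := kK.
  by rewrite Ek negb_or => /andP[_ /negPf->].
have [|p lp] := @neighbourhood_linked _ D bad _ _ _ yD u0K v0K.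
  by rewrite /bad !adjx // uv0.
have [a [s [u [v sl]]]] := exists_shortest_link lp.
have [ua_ vl_] := shortest_link_ends sl.
have [/and5P[/and4P[xu xv uv nuv] sp Dp ua vl] Up adjp _ _] := sl.
have Dp' b : b \in a :: s -> ~~ D b by move/(allP Dp).
have outx : x \notin a :: s by apply/negP => /Dp'; rewrite /D eqxx.
have outu : u \notin a :: s by apply/negP => /Dp'; rewrite /D xu orbT.
have outv : v \notin a :: s by apply/negP => /Dp'; rewrite /D xv orbT.
have Uc : uniq (x :: u :: rcons (a :: s) v).
  move: outx outu outv Up; move: (a :: s) => q xq uq vq Uq.
  rewrite 2!cons_uniq rcons_uniq inE !mem_rcons !inE !negb_or.
  by rewrite (adj_neq xu) (adj_neq xv) xq uv uq vq Uq.
have cE i j : cycle_edge (x :: u :: rcons (a :: s) v) i j =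
    [|| same_pair i j x u, same_pair i j u a, path_edge (a :: s) i j,
        same_pair i j (last a s) v | same_pair i j v x].
  rewrite cycle_edgeE // !rcons_cons 2!path_edge_cons -!rcons_cons path_edge_rcons.
  by rewrite lastI path_edge_rcons -!orbA.
have edgeC i j : cycle_edge (x :: u :: rcons (a :: s) v) i j =
    cycle_edge (x :: u :: rcons (a :: s) v) j i by exact: cycle_edgeC.
have inc i : i \in x :: u :: rcons (a :: s) v -> [\/ i = x, i = u, i = v | i \in a :: s].
  rewrite 2!inE mem_rcons inE; case/or4P=> [/eqP|/eqP|/eqP|] h;
  by [constructor 1|constructor 2|constructor 3|constructor 4].
have cc : is_cycle_seq (x :: u :: rcons (a :: s) v).
  rewrite /is_cycle_seq /ucycleb Uc andbT /= xu ua !rcons_path !last_rcons.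
  by rewrite (adj_sym v x) xv (adj_sym _ v) vl [path _ _ _]sp.
have [|i [j [ic jc ij]]] := chG _ cc; first by rewrite /= size_rcons.
suff -> : cycle_edge (x :: u :: rcons (a :: s) v) i j by [].
have edge_x k l : adj k l -> k = x -> l \in x :: u :: rcons (a :: s) v ->
    cycle_edge (x :: u :: rcons (a :: s) v) k l.
  move=> kl Ek; subst k; rewrite cE /same_pair => /inc[El|->|->|/Dp']; rewrite ?eqxx ?orbT //.
    by rewrite El adj_irrefl in kl.
  by rewrite /D kl orbT.
have edge_u k l : adj k l -> k = u -> l \in a :: s ->
    cycle_edge (x :: u :: rcons (a :: s) v) k l.
  by move=> kl Ek lp'; subst k; rewrite (ua_ l) // cE /same_pair !eqxx !orbT.
have edge_v k l : adj k l -> k = v -> l \in a :: s ->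
    cycle_edge (x :: u :: rcons (a :: s) v) k l.
  by move=> kl Ek lp'; subst k; rewrite (vl_ l) // cE /same_pair !eqxx !orbT.
have ji : adj j i by rewrite adj_sym.
case/inc: (ic) => [/(edge_x _ _ ij)/(_ jc)//|Ei|Ei|ip];
  case/inc: (jc) => [/(edge_x _ _ ji)/(_ ic)|Ej|Ej|jp].
all: rewrite 1?edgeC //.
- by rewrite Ei Ej adj_irrefl in ij.
- by rewrite Ei Ej (negPf nuv) in ij.
- by rewrite edgeC edge_u.
- by rewrite Ei Ej (negPf nuv) in ji.
- by rewrite Ei Ej adj_irrefl in ij.
- by rewrite edgeC edge_v.
- by rewrite edge_u.
- by rewrite edge_v.
by rewrite cE path_edgeC -adjp // ij !orbT.
Qed.

(** * Thetas, pyramids and prisms from three parallel arcs *)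

Section Ring.
Variable G : sgraph.
Implicit Types (u v x y : G) (E M N R : seq G).

(* Adjacency on a cycle whose arcs [M] and [N] run in parallel from the end [E]
   to the end [E']: an end is either one vertex joined to the tips of both arcs,
   or empty, and then the tips are joined to each other. With three arcs, two
   vertex ends give a theta, one gives a pyramid and none gives a prism. *)
Definition ring_pair E E' M N u v :=
  [|| path_edge (E ++ M ++ E') u v, path_edge (E ++ N ++ E') u v,
      nilp E && same_pair u v (head u M) (head u N)
    | nilp E' && same_pair u v (last u M) (last u N)].

Lemma same_pairC u v x y : same_pair u v x y = same_pair u v y x.
Proof. by rewrite /same_pair orbC. Qed.

Lemma ring_pairC E E' M N u v : ring_pair E E' M N u v = ring_pair E E' N M u v.
Proof.
by rewrite /ring_pair orbCA (same_pairC _ _ (head _ _)) (same_pairC _ _ (last _ _)).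
Qed.

Lemma size_le1P E : size E <= 1 -> E = [::] \/ exists x, E = [:: x].
Proof. by case: E => [|x []]; [left|right; exists x|]. Qed.

(** Ends of at most one vertex are their own reversals, so reversing the arcs just exchanges the
    ends. *)
Lemma ring_pair_rev E E' M N u v : size E <= 1 -> size E' <= 1 ->
  M != [::] -> N != [::] ->
  ring_pair E' E (rev M) (rev N) u v = ring_pair E E' M N u v.
Proof.
move=> E1 E1' M0 N0.
have rev1 R : size R <= 1 -> rev R = R by case/size_le1P=> [->|[x ->]].
have edge_rev R : path_edge (E' ++ rev R ++ E) u v = path_edge (E ++ R ++ E') u v.
  by rewrite -(path_edge_rev (E ++ _)) !rev_cat (rev1 E) // (rev1 E') // -catA.
have head_rev R : R != [::] -> head u (rev R) = last u R.
  by case/lastP: R => // R x _; rewrite rev_rcons last_rcons.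
have last_rev' R : R != [::] -> last u (rev R) = head u R.
  by case: R => // x R _; rewrite rev_cons last_rcons.
by rewrite /ring_pair !edge_rev !head_rev // !last_rev' // [_ && _ || _ && _]orbC.
Qed.

(** The cycle goes out along [M] and back along [N]; at an empty end it passes directly from tip to
    tip. *)
Lemma ring_cycle_edge E E' M N u v : size E <= 1 -> size E' <= 1 ->
  M != [::] -> N != [::] -> uniq (E ++ M ++ E' ++ rev N) ->
  cycle_edge (E ++ M ++ E' ++ rev N) u v = ring_pair E E' M N u v.
Proof.
move=> E1 E1' M0 N0.
have [m [hM EM]] : exists m h, M = h :: m by case: M M0 => // h m _; exists m, h.
have [m' [lM EM']] : exists m' l, M = rcons m' l
  by case/lastP: M M0 {EM} => // m' l _; exists m', l.
have [n [hN EN]] : exists n h, N = h :: n by case: N N0 => // h n _; exists n, h.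
have [n' [lN EN']] : exists n' l, N = rcons n' l
  by case/lastP: N N0 {EN} => // n' l _; exists n', l.
have -> : ring_pair E E' M N u v =
  [|| path_edge (E ++ M ++ E') u v, path_edge (E ++ N ++ E') u v,
      nilp E && same_pair u v hM hN | nilp E' && same_pair u v lM lN].
  have -> : hM = head u M by rewrite EM.
  have -> : hN = head u N by rewrite EN.
  have -> : lM = last u M by rewrite EM' last_rcons.
  by have -> : lN = last u N by rewrite EN' last_rcons.
have side2 : path_edge (E' ++ rev N ++ E) u v = path_edge (E ++ N ++ E') u v.
  have rev1 R : size R <= 1 -> rev R = R by case/size_le1P=> [->|[x ->]].
  by rewrite -(path_edge_rev (E ++ _)) !rev_cat (rev1 E) // (rev1 E') // -catA.
(* Repeating [E] closes the cycle when [E] is a vertex. When it is empty, the edge between the first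
   tips is still missing and is added below. *)
have bottom : path_edge (E ++ M ++ E' ++ rev N ++ E) u v =
    [|| path_edge (E ++ M ++ E') u v, path_edge (E ++ N ++ E') u v
      | nilp E' && same_pair u v lM lN].
  rewrite -side2; case/size_le1P: E1' => [->|[y ->]] /=.
    have X : E ++ M = rcons (E ++ m') lM by rewrite EM' rcons_cat.
    have Y : rev N ++ E = lN :: rev n' ++ E by rewrite EN' rev_rcons.
    by rewrite cats0 catA X Y path_edge_cat; congr (_ || _); rewrite orbC.
  by rewrite catA path_edge_split orbF -cats1 -catA.
have Etop := size_le1P E1.
move=> Uc; suff -> : cycle_edge (E ++ M ++ E' ++ rev N) u v =
    path_edge (E ++ M ++ E' ++ rev N ++ E) u v || nilp E && same_pair u v hM hN.
  by rewrite bottom -!orbA; do 4!congr (_ || _); apply: orbC.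
case: Etop Uc => [->|[x ->]] /= Uc; last first.
  by rewrite cycle_edgeE // orbF -cats1 !catA.
rewrite cats0 EM /= cycle_edgeE; last by rewrite -[_ :: _]/((hM :: m) ++ _) -EM.
have X : hM :: m ++ E' ++ rev N = rcons (hM :: m ++ E' ++ rev n) hN.
  by rewrite EN rev_cons -!rcons_cat.
by rewrite -rcons_cons X path_edge_rcons (same_pairC _ _ hN).
Qed.

Lemma head_mem u M : M != [::] -> head u M \in M.
Proof. by case: M => // x M _; rewrite mem_head. Qed.

Lemma last_mem u M : M != [::] -> last u M \in M.
Proof. by case/lastP: M => // M x _; rewrite last_rcons mem_rcons mem_head. Qed.

Lemma same_pair_mem u v x y M : same_pair u v x y -> x \in M -> (u \in M) || (v \in M).
Proof. by case/orP=> /andP[/eqP-> /eqP->] ->; rewrite ?orbT. Qed.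

(** Each end has at most one vertex and the nonempty arc separates the two, so no edge of the path
    avoids the arc. *)
Lemma path_edge_through E E' M u v : size E <= 1 -> size E' <= 1 -> M != [::] ->
  path_edge (E ++ M ++ E') u v -> (u \in M) || (v \in M).
Proof.
case/size_le1P=> [->|[x ->]]; case/size_le1P=> [->|[y ->]] //=.
- by rewrite cats0 => _ /path_edge_mem[->].
- case/lastP: M => // M l _; rewrite cats1 path_edge_rcons.
  case/orP=> [/path_edge_mem[->//]|/same_pair_mem]; apply.
  by rewrite mem_rcons mem_head.
- case: M => // h M _; rewrite cats0 path_edge_cons.
  case/orP=> [|/path_edge_mem[->//]]; rewrite same_pairC => /same_pair_mem.
  by apply; rewrite mem_head.
case: M => // h M _; rewrite path_edge_cons -cat_cons.
case/orP=> [|]; first by rewrite same_pairC => /same_pair_mem; apply; rewrite mem_head.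
rewrite {1}lastI cats1 path_edge_rcons -lastI => /orP[/path_edge_mem[->//]|].
by move=> /same_pair_mem; apply; rewrite mem_last.
Qed.

Lemma ring_pair_left E E' M N u v : size E <= 1 -> size E' <= 1 ->
  N != [::] -> uniq (E ++ N ++ E') -> {in N, forall w, w \notin M} ->
  u \in E ++ M ++ E' -> v \in E ++ M ++ E' ->
  ring_pair E E' M N u v = path_edge (E ++ M ++ E') u v.
Proof.
move=> E1 E1' N0 UN dMN uM vM; rewrite /ring_pair.
have notN w : w \in E ++ M ++ E' -> w \notin N.
  rewrite !mem_cat => /or3P[] wM; apply/negP => wN.
  - by move: UN; rewrite cat_uniq => /and3P[_ /hasPn/(_ w) + _]; rewrite mem_cat wN wM => /(_ isT).
  - by have := dMN w wN; rewrite wM.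
  - by move: UN; rewrite !cat_uniq => /and5P[_ _ _ /hasPn/(_ w wM) +]; rewrite /= wN.
have /negPf-> : ~~ path_edge (E ++ N ++ E') u v.
  by apply/negP => /(path_edge_through E1 E1' N0); rewrite (negPf (notN u uM)) (negPf (notN v vM)).
have npair x y : y \in N -> same_pair u v x y = false.
  move=> yN; apply/negP => /orP[] /andP[/eqP e1 /eqP e2].
    by have := notN v vM; rewrite e2 yN.
  by have := notN u uM; rewrite e1 yN.
by rewrite !npair ?head_mem ?last_mem // !andbF !orbF.
Qed.

(** The third arc meets the rest of the ring only at its tips, so its place in the ring is decided
    by the neighbours of [a] and of [last a s]. *)
Lemma ring_pair_cross E E' N a s u b : size E <= 1 -> size E' <= 1 ->
  N != [::] -> uniq (E ++ (a :: s) ++ E') -> {in N, forall w, w \notin a :: s} ->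
  u \in E ++ N ++ E' -> b \in a :: s ->
  ring_pair E E' N (a :: s) u b =
  (b == a) && ((u \in E) || nilp E && (u == head u N)) ||
  (b == last a s) && ((u \in E') || nilp E' && (u == last u N)).
Proof.
move=> E1 E1' N0 Us dN uN bs.
have notE w : w \in a :: s -> w \notin E ++ E'.
  move=> ws; rewrite mem_cat negb_or; move: Us; rewrite !cat_uniq.
  case/and5P=> _ /hasPn Es _ /hasPn sE' _; apply/andP; split.
    by have := Es w; rewrite mem_cat ws => /(_ isT).
  by apply/negP => /sE'; rewrite /= ws.
have notu : u \notin a :: s.
  apply/negP => us; move: uN; rewrite !mem_cat; have := notE u us.
  rewrite mem_cat => /norP[/negPf-> /negPf->]; rewrite orbF /= => /dN.
  by rewrite us.
have bN : b \notin E ++ N ++ E'.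
  have := notE b bs; rewrite !mem_cat => /norP[/negPf-> /negPf->]; rewrite orbF /=.
  by apply/negP => /dN; rewrite bs.
have ub x : x \in a :: s -> (u == x) = false.
  by move=> xs; apply: contraNF notu => /eqP->.
have bx x : x \notin a :: s -> (b == x) = false.
  by move=> xs; apply: contraNF xs => /eqP<-.
have edge_s : path_edge (E ++ (a :: s) ++ E') u b =
    (u \in E) && (b == a) || (u \in E') && (b == last a s).
  have Es : path_edge (a :: s) u b = false by apply: path_edge_notin; rewrite notu.
  have sE' : path_edge ((a :: s) ++ E') u b = (u \in E') && (b == last a s).
    case/size_le1P: E1' notE => [->|[y ->]] notE; first by rewrite cats0 Es.
    rewrite lastI cats1 path_edge_rcons -lastI Es /= /same_pair inE (ub (last a s)) ?mem_last //.
  case/size_le1P: E1 notE => [->|[x ->]] notE; first by rewrite sE'.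
  rewrite cat1s cat_cons path_edge_cons -cat_cons sE' /same_pair inE (ub a) ?mem_head //.
  by rewrite orbF.
rewrite /ring_pair edge_s [path_edge _ _ _]path_edge_notin ?bN ?orbT //=.
have hN : head u N \notin a :: s by apply: dN; rewrite head_mem.
have lN : last u N \notin a :: s by apply: dN; rewrite last_mem.
rewrite /same_pair (bx _ hN) (bx _ lN) !andbF !orbF.
case: (u \in E); case: (u \in E'); case: (b == a); case: (b == last a s);
  rewrite /= ?andbT ?andbF ?orbT ?orbF //.
Qed.

End Ring.

Section RingObstruction.
Variables (G : sgraph) (E E' : seq G) (M : 'I_3 -> seq G).
Hypothesis E1 : size E <= 1.
Hypothesis E1' : size E' <= 1.
Hypothesis UM : forall i, uniq (E ++ M i ++ E').
Hypothesis dM : forall i j v, v \in M i -> v \in M j -> i = j.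
Hypothesis M0 : forall i, M i != [::].
Hypothesis coverM : forall v, v \in E ++ E' \/ exists i, v \in M i.
Hypothesis adjM : forall i j, i != j -> {in E ++ M i ++ E' ++ M j &, forall u v,
  adj u v = ring_pair E E' (M i) (M j) u v}.

Lemma ring_path_edge i u v : path_edge (E ++ M i ++ E') u v -> adj u v.
Proof.
move=> uv; have [j [_ [ij _ _]]] := ord3_others i.
have inS w : w \in E ++ M i ++ E' -> w \in E ++ M i ++ E' ++ M j.
  by rewrite !mem_cat => /or3P[]->; rewrite ?orbT.
have [uS vS] := path_edge_mem uv.
by rewrite (adjM ij) ?inS // /ring_pair uv.
Qed.

(** Any two vertices lie in the ring of some two arcs, so the pairwise descriptions [adjM] account
    for every edge. *)
Lemma ring_edge u v : adj u v -> exists i j, i != j /\ ring_pair E E' (M i) (M j) u v.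
Proof.
move=> uv; have [i uS] : exists i, u \in E ++ M i ++ E'.
  case: (coverM u) => [uE|[i ui]]; last by exists i; rewrite !mem_cat ui orbT.
  by exists ord0; move: uE; rewrite !mem_cat => /orP[]->; rewrite ?orbT.
have [j [_ [ij _ _]]] := ord3_others i.
have inS w : w \in E ++ M i ++ E' -> forall k, w \in E ++ M i ++ E' ++ M k.
  by move=> wS k; move: wS; rewrite !mem_cat => /or3P[]->; rewrite ?orbT.
have key k : i != k -> v \in E ++ M i ++ E' ++ M k ->
    exists i j, i != j /\ ring_pair E E' (M i) (M j) u v.
  by move=> ik vS; exists i, k; rewrite -(adjM ik (inS _ uS k) vS).
case: (coverM v) => [vE|[k vk]].
  by apply: (key j ij); move: vE; rewrite !mem_cat => /orP[]->; rewrite ?orbT.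
have [ki|ik] := eqVneq k i.
  by apply: (key j ij); rewrite -ki !mem_cat vk orbT.
by apply: (key k); rewrite 1?eq_sym // !mem_cat vk !orbT.
Qed.

Lemma ring_uniq i j : i != j -> uniq (E ++ M i ++ E' ++ rev (M j)).
Proof.
move=> ij; have -> : E ++ M i ++ E' ++ rev (M j) = (E ++ M i ++ E') ++ rev (M j).
  by rewrite -!catA.
rewrite cat_uniq UM rev_uniq /=.
have := UM j; rewrite cat_uniq => /and3P[_ nE]; rewrite cat_uniq => /and3P[Uj nE' _].
rewrite Uj andbT /=; apply/hasPn => w; rewrite mem_rev => wj.
rewrite !mem_cat !negb_or; apply/and3P; split.
- by have /hasPn/(_ w) := nE; rewrite mem_cat wj => /(_ isT).
- by apply: contraNN ij => wi; apply/eqP; apply: dM wi wj.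
by apply/negP => wE'; have /hasPn/(_ w wE') := nE'; rewrite /= wj.
Qed.

Hypothesis sizeM : forall i j, i != j -> 4 <= size E + size E' + size (M i) + size (M j).

Lemma ring_cycle_graph i j (S : {set G}) : i != j ->
  S =i E ++ M i ++ E' ++ M j -> cycle_graph (induced S).
Proof.
move=> ij SE; apply: (cycle_graph_induced (c := E ++ M i ++ E' ++ rev (M j))).
- exact: ring_uniq.
- have := sizeM ij; rewrite !size_cat size_rev.
  by rewrite [size (M i) + _]addnCA !addnA => /ltnW.
- by move=> v; rewrite SE !mem_cat mem_rev.
move=> u v uS vS; rewrite ring_cycle_edge ?ring_uniq // (adjM ij) //.
  by move: uS; rewrite !mem_cat mem_rev.
by move: vS; rewrite !mem_cat mem_rev.
Qed.

End RingObstruction.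

Section RingObstructions.
Variables (G : sgraph) (M : 'I_3 -> seq G).
Hypothesis dM : forall i j v, v \in M i -> v \in M j -> i = j.
Hypothesis M0 : forall i, M i != [::].

Lemma ring_theta x y :
  (forall i, uniq (x :: M i ++ [:: y])) ->
  (forall v, v \in [:: x; y] \/ exists i, v \in M i) ->
  (forall i j, i != j -> {in [:: x] ++ M i ++ [:: y] ++ M j &, forall u v,
     adj u v = ring_pair [:: x] [:: y] (M i) (M j) u v}) ->
  theta G.
Proof.
move=> UM coverM adjM; pose P i := x :: rcons (M i) y.
have PE i : P i = [:: x] ++ M i ++ [:: y] by rewrite cats1.
have pairE i j u v :
    ring_pair [:: x] [:: y] (M i) (M j) u v = path_edge (P i) u v || path_edge (P j) u v.
  by rewrite /ring_pair -!PE /= orbF.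
have ring_edgeP u v : adj u v -> exists i, path_edge (P i) u v.
  case/(ring_edge (E := [:: x]) (E' := [:: y]) coverM adjM) => i [j [ij]]; rewrite pairE.
  by case/orP=> uv; [exists i|exists j].
have edgeP := ring_path_edge (E := [:: x]) (E' := [:: y]) adjM.
have sizeM i : 0 < size (M i) by rewrite lt0n size_eq0.
exists x, y, P; split.
- have xy : x != y.
    by have := UM ord0; rewrite /= cats1 mem_rcons inE negb_or -andbA => /and3P[].
  split=> //; apply/negP => /ring_edgeP[i]; rewrite PE => /path_edge_through.
  move=> /(_ isT isT (M0 i)); have := UM i; rewrite /= cats1 mem_rcons inE negb_or rcons_uniq.
  by case/and3P=> /andP[_ /negPf->] /negPf->.
- move=> i; rewrite is_pathE -cats1 UM; apply/sorted_adj => u v.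
  by rewrite -[x :: _]/([:: x] ++ _); apply: edgeP.
- move=> i j ij.
  apply: (ring_cycle_graph (E := [:: x]) (E' := [:: y]) _ _ UM dM M0 adjM _ ij) => //.
    by move=> k l _; rewrite /= -addnA (leq_add (leqnn 2)) // (leq_add (sizeM k) (sizeM l)).
  move=> v; rewrite !inE !mem_rcons !mem_cat !inE.
  by case: (v == x); case: (v == y); case: (v \in M i).
- move=> i j ij u v uS vS.
  have inS w : w \in P i ++ P j -> w \in [:: x] ++ M i ++ [:: y] ++ M j.
    rewrite mem_cat !inE !mem_rcons !mem_cat !inE.
    by case: (w == x); case: (w == y); case: (w \in M i).
  by rewrite (adjM _ _ ij) ?inS // /ring_pair /= orbF -!PE.
split=> // v; case: (coverM v) => [|[i vi]].
  by rewrite !inE => vE; exists ord0; rewrite inE mem_rcons inE; case/orP: vE => ->; rewrite ?orbT.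
by exists i; rewrite inE mem_rcons inE vi !orbT.
Qed.

Lemma ring_pyramid w :
  (forall i, uniq (w :: M i)) ->
  (forall v, v = w \/ exists i, v \in M i) ->
  (forall i j, i != j -> {in w :: M i ++ M j &, forall u v,
     adj u v = ring_pair [:: w] [::] (M i) (M j) u v}) ->
  (forall i j, i != j -> 3 <= size (M i) + size (M j)) ->
  pyramid G.
Proof.
move=> UM coverM adjM sizeM; pose z i := last w (M i).
have UM' i : uniq ([:: w] ++ M i ++ [::]) by rewrite cats0 UM.
have coverM' v : v \in [:: w] ++ [::] \/ exists i, v \in M i.
  by case: (coverM v) => [->|]; [left; rewrite mem_head|right].
have lastE u i : last u (M i) = z i.
  by rewrite /z; case: (M i) (M0 i).
have edgeP i u v : path_edge (w :: M i) u v -> adj u v.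
  rewrite -[M i]cats0; exact: (ring_path_edge (E := [:: w]) (E' := [::]) adjM).
have adjz i j : i != j -> adj (z i) (z j).
  move=> ij; rewrite (adjM _ _ ij) ?inE ?mem_cat ?last_mem ?orbT //.
  by rewrite /ring_pair /= !lastE /same_pair !eqxx !orbT.
exists w, z, (fun i => w :: M i); split=> //.
- move=> i; rewrite /is_path eqxx lastE eqxx UM andbT /=.
  by apply: (sorted_adj (w :: M i)).2 => u v; apply: edgeP.
- move=> i j ij; split.
    apply/setP=> v; rewrite !inE; case: eqP => //= _.
    by apply/negP => /andP[vi vj]; move: ij; rewrite (dM vi vj) eqxx.
  apply: (ring_cycle_graph (E := [:: w]) (E' := [::]) _ _ UM' dM M0 adjM _ ij) => //.
  move=> v; rewrite !inE mem_cat.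
  by case: (v == w); case: (v \in M i).
(* A single-edge path comes from a one-vertex arc, and two such arcs have only two vertices
   together. *)
- move=> i j /= [si] [sj]; apply/eqP; apply: contraT => /sizeM.
  by rewrite si sj.
split=> [v|u v].
  by case: (coverM v) => [->|[i vi]]; [exists ord0; rewrite mem_head|exists i; rewrite inE vi orbT].
case/(ring_edge (E := [:: w]) (E' := [::]) coverM' adjM) => i [j [ij]].
rewrite /ring_pair /= !cats0 !lastE => /or3P[uv|uv|].
- by left; exists i.
- by left; exists j.
by case/orP=> /andP[/eqP-> /eqP->]; right; [exists i, j|exists j, i].
Qed.

Lemma ring_prism :
  (forall i, uniq (M i)) -> (forall v, exists i, v \in M i) ->
  (forall i j, i != j -> {in M i ++ M j &, forall u v,
     adj u v = ring_pair [::] [::] (M i) (M j) u v}) ->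
  (forall i, 2 <= size (M i)) ->
  prism G.
Proof.
move=> UM coverM adjM sizeM.
have d : G by case: (M ord0) (M0 ord0) => // d.
pose x i := head d (M i); pose y i := last d (M i).
have headE u i : head u (M i) = x i by rewrite /x; case: (M i) (M0 i).
have lastE u i : last u (M i) = y i by rewrite /y; case: (M i) (M0 i).
have UM' i : uniq ([::] ++ M i ++ [::]) by rewrite cats0 UM.
have coverM' v : v \in ([::] ++ [::] : seq G) \/ exists i, v \in M i by right.
have edgeP i u v : path_edge (M i) u v -> adj u v.
  rewrite -[M i]cats0; exact: (ring_path_edge (E := [::]) (E' := [::]) adjM).
have xM i : x i \in M i by apply: head_mem.
have yM i : y i \in M i by apply: last_mem.
exists x, y, M; split=> //.
- split=> i j.
  + move=> ij; rewrite (adjM _ _ ij) ?mem_cat ?xM ?orbT //.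
    by rewrite /ring_pair /= !headE /same_pair !eqxx !orbT.
  + move=> ij; rewrite (adjM _ _ ij) ?mem_cat ?yM ?orbT //.
    by rewrite /ring_pair /= !lastE /same_pair !eqxx !orbT.
  (* Disjointness forces [i = j], and an arc with at least two vertices has distinct tips. *)
  apply/eqP => Exy; have Eij : i = j by apply: dM (xM i) _; rewrite Exy.
  move: Exy (UM j) (sizeM j); rewrite -{}Eij /x /y; case: (M i) => // a [|b t] //= ->.
  by rewrite mem_last.
- move=> i; rewrite /is_path; move: (UM i) (edgeP i); rewrite /x /y.
  case: (M i) (M0 i) => // a t _ -> /sorted_adj /= ->.
  by rewrite !eqxx.
- move=> i j ij; apply/setP=> v; rewrite !inE; apply/negP => /andP[vi vj].
  by move: ij; rewrite (dM vi vj) eqxx.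
- move=> i j ij.
  apply: (ring_cycle_graph (E := [::]) (E' := [::]) _ _ UM' dM M0 adjM _ ij) => //.
    by move=> k l kl; apply: (leq_add (sizeM k) (sizeM l)).
  by move=> v; rewrite !inE /= mem_cat.
split=> // u v.
case/(ring_edge (E := [::]) (E' := [::]) coverM' adjM) => i [j [ij]].
rewrite /ring_pair /= !cats0 !lastE !headE => /or4P[uv|uv||].
- by constructor 1; exists i.
- by constructor 1; exists j.
- by case/orP=> /andP[/eqP-> /eqP->]; constructor 2; [exists i, j|exists j, i].
by case/orP=> /andP[/eqP-> /eqP->]; constructor 3; [exists i, j|exists j, i].
Qed.

End RingObstructions.

(** * Links between nonadjacent vertices of a hole *)

Section Holes.
Variable G : sgraph.
Implicit Types (u v w x y z : G) (c q r s t E : seq G).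

Lemma hole_rot n c : hole c -> hole (rot n c).
Proof.
case=> Uc c4 adjc; split; rewrite ?rot_uniq ?size_rot // => u v.
by rewrite !mem_rot cycle_edge_rot //; apply: adjc.
Qed.

Lemma hole_rotr n c : hole c -> hole (rotr n c).
Proof. exact: hole_rot. Qed.

Lemma hole_rev c : hole c -> hole (rev c).
Proof.
case=> Uc c4 adjc; split; rewrite ?rev_uniq ?size_rev // => u v.
by rewrite !mem_rev cycle_edge_rev //; apply: adjc.
Qed.

Lemma hole_rot_to c x : hole c -> x \in c -> exists2 q, hole (x :: q) & x :: q =i c.
Proof.
move=> hc xc; have [n q E] := rot_to xc; exists q; first by rewrite -E; apply: hole_rot.
by move=> v; rewrite -E mem_rot.
Qed.

Lemma hole_neighbours c x : hole c -> x \in c -> exists y r z,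
  [/\ hole (x :: y :: rcons r z), x :: y :: rcons r z =i c,
      {in c, forall w, adj x w = (w == y) || (w == z)} & ~~ adj y z].
Proof.
move=> hc /(hole_rot_to hc)[[|y q] hq qc]; first by case: hq.
case/lastP: q => [|r z] in hq qc *; first by case: hq.
exists y, r, z; have [Uq q4 adjq] := hq.
have cE i j : cycle_edge (x :: y :: rcons r z) i j =
    [|| same_pair i j x y, path_edge (y :: rcons r z) i j | same_pair i j z x].
  by rewrite cycle_edgeE // rcons_cons path_edge_cons -!rcons_cons path_edge_rcons.
have := Uq; rewrite 2!cons_uniq inE !mem_rcons !inE !negb_or.
case/and3P=> /and3P[xy xz xr] /andP[yz yr] Ur.
split=> // [w|].
  rewrite -qc => wq; rewrite adjq ?mem_head // cE path_edge_notin.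
    by rewrite /same_pair eqxx (negPf xy) (negPf xz) orbF.
  by rewrite inE mem_rcons inE !negb_or xy xz xr.
have yq : y \in x :: y :: rcons r z by rewrite !inE eqxx orbT.
have zq : z \in x :: y :: rcons r z by rewrite !inE mem_rcons mem_head !orbT.
rewrite adjq // cE /same_pair !(eq_sym y x) !(eq_sym z x) (negPf xy) (negPf xz) !andbF /=.
rewrite orbF path_edge_head; last by case/andP: Uq.
case: r q4 Ur {hq qc adjq cE Uq xr yr yq zq} => //= b r _.
by rewrite mem_rcons inE negb_or => /andP[/andP[bz _] _]; rewrite eq_sym.
Qed.

(** The reason why a clique on a hole has at most two vertices. *)
Lemma hole_triangle_free c u v w : hole c -> u \in c -> v \in c -> w \in c ->
  adj u v -> adj u w -> ~~ adj v w.
Proof.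
move=> hc uc vc wc uv uw; have [y [r [z [_ _ nbr nyz]]]] := hole_neighbours hc uc.
move: uv uw; rewrite !nbr //.
by do 2![case/orP=> /eqP->]; rewrite ?adj_irrefl // adj_sym.
Qed.

(** [hole_neighbours] leaves the orientation open; the hole is reversed when [u] is the neighbour
    met first. *)
Lemma hole_centre c w u v : hole c -> w \in c -> u \in c -> v \in c -> u != v ->
  adj w u -> adj w v -> exists r, hole (w :: v :: rcons r u) /\ w :: v :: rcons r u =i c.
Proof.
move=> hc wc uc vc uv; have [y [r [z [hq qc nbr _]]]] := hole_neighbours hc wc.
rewrite !nbr // => /orP[]/eqP Eu /orP[]/eqP Ev; first by rewrite Eu Ev eqxx in uv.
- exists (rev r); split.
    have := hole_rotr 1 (hole_rev hq).
    by rewrite !rev_cons rev_rcons -rcons_cons rotr1_rcons Eu Ev.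
  by move=> k; rewrite -qc Eu Ev !inE !mem_rcons !inE mem_rev; do !bool_congr.
- by exists r; rewrite Eu Ev.
by rewrite Eu Ev eqxx in uv.
Qed.

Lemma hole_edge_ends c u v : hole c -> u \in c -> v \in c -> adj u v ->
  exists r, hole (u :: rcons r v) /\ u :: rcons r v =i c.
Proof.
move=> hc uc vc uv; have [y [r [z [hq qc nbr _]]]] := hole_neighbours hc uc.
move: uv; rewrite nbr // => /orP[]/eqP Ev; last first.
  by exists (y :: r); rewrite Ev.
exists (z :: rev r); split.
  have := hole_rotr 1 (hole_rev hq).
  by rewrite !rev_cons rev_rcons -rcons_cons rotr1_rcons Ev.
by move=> k; rewrite -qc Ev !inE !mem_rcons !inE mem_rev; do !bool_congr.
Qed.

(* A nonempty clique [A] on a hole becomes an end of the arcs into which the hole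
   is cut: a single vertex, or an edge joining the two tips. *)
Lemma hole_first_end c (A : pred G) u0 : hole c -> u0 \in c -> A u0 ->
  {in c &, forall u w, A u -> A w -> u != w -> adj u w} ->
  exists E t, [/\ hole (E ++ t), E ++ t =i c, size E <= 1, t != [::]
    & {in c, forall u, A u = (u \in E) || nilp E && ((u == head u t) || (u == last u t))}].
Proof.
move=> hc u0c Au0 cA.
case: (altP (@hasP _ [pred w | A w && (w != u0)] c)) => [[u1 u1c /andP[Au1 u10]]|none].
  have u01 : adj u0 u1 by apply: cA; rewrite 1?eq_sym.
  have [r [hr rc]] := hole_edge_ends hc u0c u1c u01.
  exists [::], (u0 :: rcons r u1); split=> // u uc /=.
  rewrite last_rcons; apply/idP/orP=> [Au|[]/eqP-> //].
  have [_|uu0] := eqVneq u u0; first by left.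
  have [_|uu1] := eqVneq u u1; first by right.
  have := hole_triangle_free hc u0c u1c uc u01.
  by rewrite !cA // 1?eq_sym // => /(_ isT).
have [q hq qc] := hole_rot_to hc u0c.
exists [:: u0], q; split=> // [|u uc]; first by case: q hq {qc} => [[]|].
rewrite inE orbF; apply/idP/eqP=> [Au|->//].
apply: contraNeq none => uu0; apply/hasP; exists u => //=; by rewrite Au uu0.
Qed.

Lemma hole_edge_tail E t u v : size E <= 1 -> hole (E ++ t) -> u \in t -> v \in t ->
  adj u v -> path_edge t u v || nilp E && same_pair u v (head u t) (last u t).
Proof.
move=> E1 [Uc c4 adjc] ut vt; rewrite adjc ?mem_cat ?ut ?vt ?orbT //.
case/size_le1P: E1 Uc c4 => [->|[x ->]] Uc c4.
  case: t ut vt Uc c4 {adjc} => // y t ut vt Uc c4.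
  rewrite cycle_edgeE // -rcons_cons {1}(lastI y t) path_edge_rcons -lastI /=.
  by rewrite (same_pairC _ _ y).
case: t ut vt Uc {adjc c4} => // y t ut vt Uc.
rewrite cycle_edgeE // rcons_cons path_edge_cons -rcons_cons {1}(lastI y t) path_edge_rcons -lastI.
have := Uc; rewrite cons_uniq => /andP[xt _].
have nx w : w \in y :: t -> (w == x) = false by move=> wt; apply: contraNF xt => /eqP<-.
by rewrite /same_pair !nx // !andbF /= !orbF.
Qed.

(** The hole is already opened at its first end; the second clique [B] avoids that end and cuts [t]
    into the two arcs, at a vertex or between two consecutive vertices. *)
Lemma hole_second_end E t (B : pred G) u0 v0 : size E <= 1 -> t != [::] -> hole (E ++ t) ->
  u0 \in E ++ t -> v0 \in t -> B v0 -> u0 != v0 -> ~~ adj u0 v0 ->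
  {in E ++ t, forall u, B u ->
     (u \notin E) && ~~ (nilp E && ((u == head u t) || (u == last u t)))} ->
  (u0 \in E) || nilp E ->
  {in t &, forall u w, B u -> B w -> u != w -> adj u w} ->
  exists M E' R, [/\ t = M ++ E' ++ R, size E' <= 1, M != [::], R != [::]
    & {in E ++ t, forall u, B u = (u \in E') || nilp E' && ((u == last u M) || (u == head u R))}].
Proof.
move=> E1 t0 ht u0c v0t Bv0 uv0 nuv0 Bends u0E cB.
have inT w : w \in t -> w \in E ++ t by rewrite mem_cat orbC => ->.
have BT w : w \in E ++ t -> B w -> w \in t.
  by move=> wc Bw; have /andP[wE _] := Bends w wc Bw; rewrite mem_cat (negPf wE) in wc.
have [Uc _ adjc] := ht.
have Ut : uniq t by move: Uc; rewrite cat_uniq => /and3P[].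
case: (altP (@hasP _ [pred w | B w && (w != v0)] t)) => [[v1 v1t /andP[Bv1 v10]]|none].
  have v01 : adj v0 v1 by apply: cB; rewrite 1?eq_sym.
  have two x y M R : t = rcons M x ++ y :: R -> B x -> B y ->
      {in E ++ t, forall u, B u = (u == x) || (u == y)}.
    move=> Et Bx By u uc; have xt : x \in t by rewrite Et mem_cat mem_rcons mem_head.
    have yt : y \in t by rewrite Et mem_cat mem_head orbT.
    apply/idP/orP=> [Bu|[]/eqP-> //].
    have [_|ux] := eqVneq u x; first by left.
    have [_|uy] := eqVneq u y; first by right.
    have xy : x != y.
      move: Ut; rewrite Et cat_uniq => /and3P[_ /hasPn/(_ y (mem_head _ _)) + _].
      by rewrite /= mem_rcons inE negb_or eq_sym => /andP[].
    have ut := BT u uc Bu.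
    have := hole_triangle_free ht (inT _ xt) (inT _ yt) uc (cB _ _ xt yt Bx By xy).
    by rewrite !cB // 1?eq_sym // => /(_ isT).
  have cut x y : B x -> B y -> step t x y ->
      exists M E' R, [/\ t = M ++ E' ++ R, size E' <= 1, M != [::], R != [::]
    & {in E ++ t, forall u, B u = (u \in E') || nilp E' && ((u == last u M) || (u == head u R))}].
    move=> Bx By /infixP[M [R Et]]; have {}Et : t = rcons M x ++ y :: R by rewrite Et cat_rcons.
    exists (rcons M x), [::], (y :: R); split=> //.
      by case: (M).
    by move=> u uc; rewrite (two x y M R Et) // last_rcons.
  case/orP: (hole_edge_tail E1 ht v0t v1t v01) => [/orP[]|]; try exact: cut.
  (* The edge closing the hole across an empty first end joins the tips of [t], which [Bends] keeps
     out of [B]. *)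
  case/andP=> E0 /orP[]/andP[/eqP e0 _].
    by have := Bends v0 (inT _ v0t) Bv0; rewrite E0 -e0 eqxx andbF.
  by have := Bends v0 (inT _ v0t) Bv0; rewrite E0 -e0 eqxx orbT andbF.
have only u : u \in E ++ t -> B u = (u == v0).
  move=> uc; apply/idP/eqP=> [Bu|->//].
  apply: contraNeq none => uv; apply/hasP; exists u; rewrite /= ?Bu //.
  exact: BT.
have [M [R Et]] : exists M R, t = M ++ v0 :: R by case/splitPr: v0t => M R; exists M, R.
exists M, [:: v0], R; split=> //; last by move=> u uc; rewrite only // inE orbF.
(* Were an arc empty, [v0] would be next to the first end: a tip of [t] if that end is empty,
   against [Bends], and otherwise a neighbour of [u0]. *)
- apply/negP => /eqP M0.
  case/size_le1P: E1 => [E0|[x Ex]].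
    by have := Bends v0 (inT _ v0t) Bv0; rewrite E0 Et M0 /= eqxx.
  move: u0E; rewrite Ex orbF inE => /eqP Eu0.
  move: nuv0; rewrite (adjc _ _ u0c (inT _ v0t)).
  move: Uc; rewrite Ex Et M0 => Uc; rewrite cycle_edgeE //.
  by rewrite Eu0 /= path_edge_cons /same_pair !eqxx.
apply/negP => /eqP R0.
case/size_le1P: E1 => [E0|[x Ex]].
  by have := Bends v0 (inT _ v0t) Bv0; rewrite E0 Et R0 /= last_cat /= eqxx orbT.
move: u0E; rewrite Ex orbF inE => /eqP Eu0.
move: nuv0; rewrite (adjc _ _ u0c (inT _ v0t)).
move: Uc; rewrite Ex Et R0 => Uc; rewrite cycle_edgeE //.
by rewrite Eu0 /= cats1 -!rcons_cons path_edge_rcons /same_pair !eqxx !orbT.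
Qed.

End Holes.

Section ArcsToRing.
Variable G : sgraph.
Implicit Types (u v w z b : G) (E M N : seq G).

Lemma same_pair_sym u v x y : same_pair u v x y = same_pair v u x y.
Proof. by rewrite /same_pair orbC ![(v == _) && _]andbC. Qed.

Lemma ring_pair_sym E E' M N u v : M != [::] -> N != [::] ->
  ring_pair E E' M N u v = ring_pair E E' M N v u.
Proof.
case: M => // m M _; case: N => // n N _.
by rewrite /ring_pair /= !(path_edgeC _ u) !(same_pair_sym u).
Qed.

Lemma path_edge_inner E E' M u v : size E <= 1 -> size E' <= 1 ->
  uniq (E ++ M ++ E') -> u \in M -> v \in M ->
  path_edge (E ++ M ++ E') u v = path_edge M u v.
Proof.
move=> E1 E1' U uM vM.
have [nE nE'] : {in M, forall w, w \notin E} /\ {in M, forall w, w \notin E'}.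
  move: U; rewrite !cat_uniq => /and5P[_ /hasPn nE _ /hasPn nE' _]; split=> w wM.
    by have := nE w; rewrite mem_cat wM => /(_ isT).
  by apply/negP => /nE'; rewrite /= wM.
have npair x y : x \notin M -> same_pair u v x y = false.
  by move=> xM; apply/negP => /orP[]/andP[/eqP e1 /eqP e2]; move: xM; rewrite -?e1 -?e2 ?uM ?vM.
have [m [k EM]] : exists m k, M = m :: k by case: (M) uM => // m k; exists m, k.
have inner : path_edge (M ++ E') u v = path_edge M u v.
  case/size_le1P: E1' nE' => [->|[y ->]] nE'; first by rewrite cats0.
  rewrite EM lastI cats1 path_edge_rcons -lastI -EM same_pairC npair ?orbF //.
  by apply/negP => /nE'; rewrite mem_head.
case/size_le1P: E1 nE => [->|[x ->]] nE //.
rewrite EM cat1s cat_cons path_edge_cons -cat_cons -EM inner npair //.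
by apply/negP => /nE; rewrite mem_head.
Qed.

(* The link [a :: s] is the third arc of a ring whose first two arcs [N], [N'] form the hole. *)
Lemma link_ring_pair E E' N N' a s : size E <= 1 -> size E' <= 1 ->
  N != [::] -> N' != [::] -> s != [::] ->
  uniq (E ++ N ++ E') -> uniq (E ++ N' ++ E') -> uniq (E ++ (a :: s) ++ E') ->
  {in N', forall w, w \notin N} -> {in N, forall w, w \notin a :: s} ->
  {in E ++ N ++ E' &, forall u v, adj u v = ring_pair E E' N N' u v} ->
  {in a :: s &, forall u v, adj u v = path_edge (a :: s) u v} ->
  {in E ++ N ++ E', forall w, adj w a =
     (w \in E) || nilp E && ((w == head w N) || (w == head w N'))} ->
  {in E ++ N ++ E', forall w, adj w (last a s) =
     (w \in E') || nilp E' && ((w == last w N) || (w == last w N'))} ->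
  {in E ++ N ++ E', forall w b, b \in a :: s -> b != a -> b != last a s -> ~~ adj w b} ->
  {in E ++ N ++ E' ++ (a :: s) &, forall u v,
     adj u v = ring_pair E E' N (a :: s) u v}.
Proof.
move=> E1 E1' N0 N0' s0 UN UN' Up dN dp adjN adjp adja adjl adjb.
have ends w : w \in E ++ N ++ E' -> (w == head w N') = false /\ (w == last w N') = false.
  move=> wN; have wN' : w \notin N'.
    apply/negP => wN'; have := dN w wN'; move: UN' wN; rewrite !mem_cat !cat_uniq.
    case/and5P=> _ /hasPn nE _ /hasPn nE' _ /or3P[wE|->//|/nE'].
      by have := nE w; rewrite mem_cat wN' wE => /(_ isT).
    by rewrite /= wN'.
  by split; apply: contraNF wN' => /eqP->; rewrite ?head_mem ?last_mem.
have al : a != last a s.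
  have : uniq (a :: s) by move: Up; rewrite cat_uniq => /and3P[_ _]; rewrite cat_uniq => /and3P[].
  case/lastP: s s0 {Up adjp adjl adjb dp} => // t l _; rewrite last_rcons /= mem_rcons inE negb_or.
  by case/andP=> /andP[].
have cross u b : u \in E ++ N ++ E' -> b \in a :: s ->
    adj u b = ring_pair E E' N (a :: s) u b.
  move=> uN bs; rewrite ring_pair_cross //.
  have [hu lu] := ends u uN.
  have [->|ba] := eqVneq b a.
    by rewrite adja // hu orbF (negPf al) /= orbF.
  have [->|bl] := eqVneq b (last a s).
    by rewrite adjl // lu orbF.
  by rewrite /=; apply: negPf; apply: adjb.
have mem w : w \in E ++ N ++ E' ++ (a :: s) -> (w \in E ++ N ++ E') || (w \in a :: s).
  by rewrite !mem_cat !orbA.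
move=> u v /mem/orP[uN|us] /mem/orP[vN|vs].
- by rewrite adjN // !ring_pair_left //; move=> w ws; apply/negP => /dp; rewrite ws.
- exact: cross.
- by rewrite adj_sym ring_pair_sym // cross.
rewrite adjp // ring_pairC ring_pair_left ?path_edge_inner //.
  by rewrite !mem_cat us orbT.
by rewrite !mem_cat vs orbT.
Qed.

End ArcsToRing.

(** * A hole together with a shortest link *)

Definition far_in (G : sgraph) (c : seq G) : rel G :=
  fun u v => [&& u \in c, v \in c, u != v & ~~ adj u v].

Section LinkedHole.
Variables (G : sgraph) (c : seq G).
Hypothesis hc : hole c.
Implicit Types (u v w x y z b a : G) (s : seq G).

Lemma far_inN w z : w \in c -> z \in c -> w != z -> ~~ far_in c w z -> adj w z.
Proof. by move=> wc zc wz; rewrite /far_in wc zc wz negbK. Qed.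

(** A link with one vertex has empty truncations and escapes the dichotomy; its vertex is the
    centre, with the hole as rim. *)
Lemma short_link_wheel a u v : linked (mem c) (far_in c) [:: a] u v ->
  (forall w, w \in c \/ w = a) -> theta_partial_wheel G.
Proof.
case/and5P=> /and4P[uc vc uv nuv] _; rewrite /= andbT => ac ua va cover.
have [Uc c4 adjc] := hc; exists a, c; split=> //; last first.
  by exists u, v; split=> //; rewrite adj_sym.
split=> //; first exact: is_cycle_seq_chordless (ltnW c4) adjc.
by move=> w; case: (cover w); [right|left].
Qed.

(** Each truncation attaches to a clique containing [w]; one clique contains [u] and the other [v].
    Hence [u] and [v] are the two neighbours of [w] on the hole. *)
Lemma common_attachment_wheel a s u v w b b' :
  shortest_link (mem c) (far_in c) a s u v ->
  (forall w, w \in c \/ w \in a :: s) ->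
  w \in c -> b \in belast a s -> adj w b -> b' \in s -> adj w b' ->
  theta_partial_wheel G.
Proof.
move=> sl cover wc bb wb bs wb'.
have [ua_ vl_] := shortest_link_ends sl.
have [/and5P[/and4P[uc vc uv nuv] _ /allP Dp /= ua vl] _ _ Hbelast Hs] := sl.
have [_ Up adjp _ _] := sl.
have ab : a \in belast a s by case: (s) bb => //= k l _; rewrite mem_head.
have ls : last a s \in s by case: (s) bs => //= k l _; rewrite mem_last.
have far_uv : far_in c u v by rewrite /far_in uc vc uv.
(* [u] sees only the first vertex of the link and [v] only the last, while [w] sees both
   truncations. *)
have wu : w != u.
  by apply/eqP => Ewu; have := Hs b' (last a s) bs ls u v far_uv; rewrite -Ewu wb' vl => /(_ isT).
have wv : w != v.
  by apply/eqP => Ewv; have := Hbelast a b ab bb u v far_uv ua; rewrite -Ewv wb.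
have awu : adj w u.
  apply: far_inN => //; apply/negP => /(Hbelast b a bb ab) /(_ wb).
  by rewrite ua.
have awv : adj w v.
  apply: far_inN => //; apply/negP => /(Hs b' (last a s) bs ls) /(_ wb').
  by rewrite vl.
have [r [hq qc]] := hole_centre hc wc uc vc uv awu awv.
have [q Eq] : exists q, q = v :: rcons r u by exists (v :: rcons r u).
rewrite -Eq in hq qc; have [Uwq q4 adjq] := hq.
have [wq Uq] : w \notin q /\ uniq q by move: Uwq; rewrite cons_uniq => /andP[].
have qinc i : i \in q -> i \in c by move=> iq; rewrite -qc inE iq orbT.
have pc i : i \in a :: s -> i \notin c by exact: Dp.
(* A hole vertex attached to the link shares the clique of some truncation with [w], so it is [u] or
   [v]. *)
have nbr i j : i \in q -> j \in a :: s -> adj i j -> i = u /\ j = a \/ i = v /\ j = last a s.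
  move=> iq jp ij; have iw : i != w by apply: contraNneq wq => <-.
  have adjiw : adj w i.
    rewrite adj_sym; apply: far_inN (qinc _ iq) wc iw _; apply/negP => far_iw.
    case/orP: (jp : (j == a) || (j \in s)) => [/eqP Ej|js].
      by have := Hbelast a b ab bb i w far_iw; rewrite -Ej ij wb => /(_ isT).
    by have := Hs j b' js bs i w far_iw ij; rewrite wb'.
  have [y [r' [z [_ _ nbrw _]]]] := hole_neighbours hc wc.
  move: adjiw awu awv; rewrite (nbrw _ (qinc _ iq)) (nbrw _ uc) (nbrw _ vc)
    => /orP[]/eqP Ei /orP[]/eqP Eu /orP[]/eqP Ev;
    try (by move: uv; rewrite Eu Ev eqxx).
  - by left; split; [rewrite Ei Eu|apply: ua_; rewrite // Eu -Ei].
  - by right; split; [rewrite Ei Ev|apply: vl_; rewrite // Ev -Ei].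
  - by right; split; [rewrite Ei Ev|apply: vl_; rewrite // Ev -Ei].
  - by left; split; [rewrite Ei Eu|apply: ua_; rewrite // Eu -Ei].
have adj_q : {in q &, forall i j, adj i j = path_edge q i j}.
  have qwq k : k \in q -> k \in w :: q by rewrite in_cons => ->; rewrite orbT.
  move=> i j iq jq; rewrite (adjq _ _ (qwq _ iq) (qwq _ jq)) cycle_edgeE //.
  have nw k : k \in q -> (k == w) = false by move=> kq; apply: contraNF wq => /eqP<-.
  rewrite {1}Eq rcons_cons path_edge_cons -!rcons_cons path_edge_rcons rcons_cons -Eq.
  by rewrite /same_pair !nw // !andbF /= !orbF.
have vq : v \in q by rewrite Eq mem_head.
have uq : u \in q by rewrite Eq inE mem_rcons mem_head orbT.
have Ucq : uniq ((a :: s) ++ q).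
  rewrite cat_uniq Up Uq andbT; apply/hasPn => k /qinc kc.
  by apply/negP => /pc; rewrite kc.
(* The rim follows the link from [a] to its last vertex, steps to [v], and returns along the hole
   without [w] to [u], next to [a]. *)
have cE i j : cycle_edge ((a :: s) ++ q) i j = [|| path_edge (a :: s) i j,
    same_pair i j (last a s) v, path_edge q i j | same_pair i j u a].
  rewrite [in LHS]cat_cons cycle_edgeE // rcons_cat -cat_cons {1}(lastI a s) {1}Eq rcons_cons.
  by rewrite path_edge_cat -lastI -!rcons_cons path_edge_rcons rcons_cons -Eq.
have chordless : {in (a :: s) ++ q &, forall i j, adj i j = cycle_edge ((a :: s) ++ q) i j}.
  have cross i j : i \in q -> j \in a :: s -> adj i j -> cycle_edge ((a :: s) ++ q) i j.
    move=> iq jp /(nbr _ _ iq jp)[[-> ->]|[-> ->]]; rewrite cE /same_pair !eqxx ?orbT //.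
  move=> i j; rewrite !mem_cat => ipq jpq; apply/idP/idP=> [ij|].
    case/orP: ipq => [ip|iq]; case/orP: jpq => [jp|jq].
    - by rewrite cE -adjp // ij.
    - by rewrite cycle_edgeC cross // adj_sym.
    - exact: cross.
    - by rewrite cE -(adj_q i j) // ij !orbT.
  have sadj x y k l : adj x y -> same_pair k l x y -> adj k l.
    by move=> xy /orP[]/andP[/eqP-> /eqP->]; rewrite // adj_sym.
  rewrite cE => /or4P[ij||ij|].
  - by have [ip jp] := path_edge_mem ij; rewrite adjp.
  - by apply: sadj; rewrite adj_sym.
  - by have [iq jq] := path_edge_mem ij; rewrite adj_q.
  - exact: sadj.
have size_pq : 4 <= size ((a :: s) ++ q).
  rewrite size_cat Eq /= size_rcons; case: (s) bs => //= k l _.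
  by rewrite !addSn !addnS.
exists w, ((a :: s) ++ q); split=> //.
  split=> //; first exact: is_cycle_seq_chordless Ucq (ltnW size_pq) chordless.
    by rewrite mem_cat negb_or wq andbT; apply/negP => /pc; rewrite wc.
  move=> k; case: (cover k) => [|kp]; last by right; rewrite mem_cat kp.
  by rewrite -qc inE => /predU1P[->|kq]; [left|right; rewrite mem_cat kq orbT].
by exists u, v; split; rewrite ?mem_cat ?uq ?vq ?orbT.
Qed.

(** Taking [b = b'] in the separation hypothesis isolates the inner vertices of the link from the
    hole. The neighbours of [a] and of [last a s] become the ends [E] and [E'], and the number of
    empty ends selects theta, pyramid or prism. *)
Lemma separate_attachments_ring a s u v :
  shortest_link (mem c) (far_in c) a s u v ->
  (forall w, w \in c \/ w \in a :: s) -> s != [::] ->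
  (forall w b b', w \in c -> b \in belast a s -> b' \in s -> adj w b -> ~~ adj w b') ->
  [\/ prism G, pyramid G | theta G].
Proof.
move=> sl cover s0 sep.
have [/and5P[/and4P[uc vc uv nuv] _ /allP Dp /= ua vl] _ _ Hbelast Hs] := sl.
have [_ Up adjp _ _] := sl.
have ab : a \in belast a s by case: (s) s0 => //= k l _; rewrite mem_head.
have ls : last a s \in s by case: (s) s0 => //= k l _; rewrite mem_last.
have pc i : i \in a :: s -> i \notin c by exact: Dp.
have cliqueA : {in c &, forall w z, adj w a -> adj z a -> w != z -> adj w z}.
  move=> w z wc zc wa za wz; apply: far_inN => //; apply/negP => far_wz.
  by have := Hbelast a a ab ab w z far_wz wa; rewrite za.
have cliqueB : {in c &, forall w z, adj w (last a s) -> adj z (last a s) -> w != z -> adj w z}.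
  move=> w z wc zc wl zl wz; apply: far_inN => //; apply/negP => far_wz.
  by have := Hs _ _ ls ls w z far_wz wl; rewrite zl.
have [E [t [ht tc E1 t0 AE]]] := hole_first_end (A := fun w => adj w a) hc uc ua cliqueA.
have BnA w : w \in c -> adj w (last a s) -> ~~ adj w a.
  by move=> wc wl; apply/negP => wa; have := sep w a _ wc ab ls wa; rewrite wl.
have vt : v \in t.
  have := BnA v vc vl; rewrite AE // negb_or => /andP[vE _].
  by move: vc; rewrite -tc mem_cat (negPf vE).
have [||||M1 [E' [R [Et E1' M10 R0 BE]]]] :=
  @hole_second_end G E t (fun w => adj w (last a s)) u v E1 t0 ht _ vt vl uv nuv.
- by rewrite tc.
- by move=> w; rewrite tc => wc /(BnA w wc); rewrite AE // negb_or.
- by move: ua; rewrite AE // => /orP[->//|/andP[->]]; rewrite orbT.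
- by move=> w z wt zt; apply: cliqueB; rewrite -tc mem_cat ?wt ?zt orbT.
(* [R] follows the hole from the second end back to the first; reversed, it runs from [E] to [E']
   like [M1]. *)
have [Uc c4 adjc] := ht; pose M2 := rev R.
have M20 : M2 != [::] by rewrite -size_eq0 size_rev size_eq0.
have ER : R = rev M2 by rewrite revK.
have cE : E ++ t = E ++ M1 ++ E' ++ rev M2 by rewrite Et -ER.
rewrite {}cE in Uc c4 adjc tc BE ht.
have adjc12 : {in E ++ M1 ++ E' ++ rev M2 &, forall w z, adj w z = ring_pair E E' M1 M2 w z}.
  by move=> w z wc zc; rewrite adjc // ring_cycle_edge.
have headt w : head w t = head w M1 by rewrite Et; case: (M1) M10.
have lastt w : last w t = head w M2.
  by rewrite Et !last_cat ER; case: (M2) M20 => // k l _; rewrite rev_cons last_rcons.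
have headR w : head w R = last w M2.
  by rewrite ER; case/lastP: (M2) M20 => // k l _; rewrite rev_rcons last_rcons.
have inc w : (w \in c) = [|| w \in E, w \in M1, w \in E' | w \in M2].
  by rewrite -tc !mem_cat mem_rev.
have {}AE : {in c, forall w, adj w a =
    (w \in E) || nilp E && ((w == head w M1) || (w == head w M2))}.
  by move=> w wc; rewrite AE // headt lastt.
have {}BE : {in c, forall w, adj w (last a s) =
    (w \in E') || nilp E' && ((w == last w M1) || (w == last w M2))}.
  by move=> w wc; rewrite BE ?tc // headR.
have inner w b : w \in c -> b \in a :: s -> b != a -> b != last a s -> ~~ adj w b.
  move=> wc bp ba bl; have bs : b \in s by move: bp; rewrite inE (negPf ba).
  have bb : b \in belast a s by move: bp; rewrite lastI mem_rcons inE (negPf bl).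
  by apply/negP => wb; have := sep w b b wc bb bs wb; rewrite wb.
have U12 : uniq (E ++ M1 ++ E') /\ uniq (E ++ M2 ++ E').
  have perm2 : perm_eq (E ++ M1 ++ E' ++ rev M2) (E ++ (M2 ++ E') ++ M1).
    rewrite perm_cat2l perm_sym perm_catC perm_cat2l perm_catC perm_cat2l.
    by rewrite perm_sym perm_rev.
  split; first by move: Uc; rewrite !catA cat_uniq => /and3P[].
  by move: Uc; rewrite (perm_uniq perm2) catA cat_uniq => /and3P[].
have [U1 U2] := U12.
have d12 : {in M2, forall w, w \notin M1}.
  move=> w w2; apply/negP => w1; move: Uc; rewrite cat_uniq => /and3P[_ _].
  rewrite cat_uniq => /and3P[_ /hasPn/(_ w) + _].
  by rewrite mem_cat mem_rev w2 orbT /= w1 => /(_ isT).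
have d21 : {in M1, forall w, w \notin M2}.
  by move=> w w1; apply/negP => /d12; rewrite w1.
have cp w : w \in c -> w \notin a :: s by move=> wc; apply/negP => /pc; rewrite wc.
have U3 : uniq (E ++ (a :: s) ++ E').
  have UE : uniq (E ++ E').
    by apply: subseq_uniq U1; rewrite cat_subseq // suffix_subseq.
  rewrite cat_uniq cat_uniq Up; move: UE; rewrite cat_uniq => /and3P[-> /hasPn nE ->].
  apply/and5P; split=> //; apply/hasPn => w; last first.
    by move=> wE'; apply: cp; rewrite inc wE' !orbT.
  rewrite mem_cat => /orP[/pc|/nE//]; rewrite inc; by apply: contraNN => ->.
pose M (i : 'I_3) := nth [::] [:: M1; M2; a :: s] i.
have UM i : uniq (E ++ M i ++ E') by elim/ord3_ind: i.
have M0 i : M i != [::] by elim/ord3_ind: i.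
have Mc w : w \in M1 \/ w \in M2 -> w \in c by rewrite inc => -[]->; rewrite ?orbT.
have dM i j w : w \in M i -> w \in M j -> i = j.
  elim/ord3_ind: i; elim/ord3_ind: j => //= wi wj.
  - by move: (d12 _ wj); rewrite wi.
  - by move: (cp w); rewrite Mc ?wi //; [move=> /(_ isT); rewrite wj|left].
  - by move: (d12 _ wi); rewrite wj.
  - by move: (cp w); rewrite Mc; [move=> /(_ isT); rewrite wj|right].
  - by move: (cp w); rewrite Mc; [move=> /(_ isT); rewrite wi|left].
  - by move: (cp w); rewrite Mc; [move=> /(_ isT); rewrite wi|right].
have coverM w : w \in E ++ E' \/ exists i, w \in M i.
  case: (cover w) => [|wp]; last by right; exists (@Ordinal 3 2 isT).
  rewrite inc mem_cat => /or4P[->|w1|->|w2]; first by left.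
  - by right; exists (@Ordinal 3 0 isT).
  - by left; rewrite orbT.
  - by right; exists (@Ordinal 3 1 isT).
have inc1 w : w \in E ++ M1 ++ E' -> w \in c.
  by rewrite inc !mem_cat => /or3P[]->; rewrite ?orbT.
have inc2 w : w \in E ++ M2 ++ E' -> w \in c.
  by rewrite inc !mem_cat => /or3P[]->; rewrite ?orbT.
have adj12 : {in c &, forall w z, adj w z = ring_pair E E' M1 M2 w z}.
  by move=> w z wc zc; apply: adjc12; rewrite tc.
have adj1p : {in E ++ M1 ++ E' ++ (a :: s) &, forall w z, adj w z = ring_pair E E' M1 (a :: s) w z}.
  apply: (link_ring_pair (N' := M2)) => //.
  - by move=> w w1; apply/cp/Mc; left.
  - by move=> w z /inc1 wc /inc1 zc; apply: adj12.
  - by move=> w /inc1; apply: AE.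
  - by move=> w /inc1; apply: BE.
  - by move=> w /inc1 wc b; apply: inner.
have adj2p : {in E ++ M2 ++ E' ++ (a :: s) &, forall w z, adj w z = ring_pair E E' M2 (a :: s) w z}.
  apply: (link_ring_pair (N' := M1)) => //.
  - by move=> w w1; apply/cp/Mc; right.
  - by move=> w z /inc2 wc /inc2 zc; rewrite ring_pairC; apply: adj12.
  - by move=> w /inc2/AE->; rewrite [(_ == head w M1) || _]orbC.
  - by move=> w /inc2/BE->; rewrite [(_ == last w M1) || _]orbC.
  - by move=> w /inc2 wc b; apply: inner.
have swap N N' w : (w \in E ++ N ++ E' ++ N') = (w \in E ++ N' ++ E' ++ N).
  by rewrite !mem_cat; case: (w \in N); case: (w \in N'); rewrite ?orbT.
have adjM i j : i != j -> {in E ++ M i ++ E' ++ M j &, forall w z,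
    adj w z = ring_pair E E' (M i) (M j) w z}.
  elim/ord3_ind: i; elim/ord3_ind: j => //= _ w z wS zS.
  - rewrite adj12 // inc.
      by move: wS; rewrite !mem_cat => ->.
    by move: zS; rewrite !mem_cat => ->.
  - rewrite ring_pairC adj12 // inc.
      by move: wS; rewrite swap !mem_cat => ->.
    by move: zS; rewrite swap !mem_cat => ->.
  - by rewrite ring_pairC adj1p // swap.
  - by rewrite ring_pairC adj2p // swap.
have szp : 2 <= size (a :: s) by case: (s) s0.
have sz1 : 0 < size M1 by rewrite lt0n size_eq0.
have sz2 : 0 < size M2 by rewrite lt0n size_eq0.
have szc : 4 <= size E + size E' + size M1 + size M2.
  by move: c4; rewrite !size_cat size_rev [size M1 + _]addnCA !addnA.
(* Beside a single vertex end, a hole of length at least 4 leaves three vertices for its two arcs;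
   the link has at least two, and each arc at least one. *)
have szM : size E + size E' = 1 -> forall i j, i != j -> 3 <= size (M i) + size (M j).
  move=> EE'; rewrite EE' -addnA addSn ltnS in szc.
  have sz1p := leq_add sz1 szp; have sz2p := leq_add sz2 szp.
  elim/ord3_ind; elim/ord3_ind=> // _; first [exact: szc | exact: sz1p | exact: sz2p |
    rewrite addnC; first [exact: szc | exact: sz1p | exact: sz2p]].
case/size_le1P: (E1) => [E0|[x Ex]]; case/size_le1P: (E1') => [E0'|[y Ey]].
- constructor 1; rewrite E0 E0' in UM coverM adjM AE BE.
  (* With both ends empty, the vertex of a one-vertex arc would be adjacent to both [a] and
     [last a s]. *)
  have size2 N : N != [::] -> (forall w, w \in N -> w \in c) ->
      (forall w, w \in N -> w = head w N -> adj w a) ->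
      (forall w, w \in N -> w = last w N -> adj w (last a s)) -> 2 <= size N.
    case: N => // k [|//] _ Nc Na Nl; have := BnA k (Nc k (mem_head _ _)).
    by rewrite Na ?Nl ?mem_head // => /(_ isT).
  apply: (ring_prism dM M0) => //.
  + by move=> i; have := UM i; rewrite cats0.
  + by move=> w; case: (coverM w).
  elim/ord3_ind => //; apply: size2 => // w wN.
  + by apply: Mc; left.
  + by move=> Ew; rewrite AE ?Mc //= -?Ew ?eqxx //; left.
  + by move=> Ew; rewrite BE ?Mc //= -?Ew ?eqxx //; left.
  + by apply: Mc; right.
  + by move=> Ew; rewrite AE ?Mc //= -?Ew ?eqxx ?orbT //; right.
  + by move=> Ew; rewrite BE ?Mc //= -?Ew ?eqxx ?orbT //; right.
- constructor 2; rewrite E0 Ey in UM coverM adjM szM.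
  (* The apex is the second end here, while [ring_pyramid] expects it first. *)
  apply: (@ring_pyramid G (fun i => rev (M i)) _ _ y) => //.
  + by move=> i j w; rewrite !mem_rev; apply: dM.
  + by move=> i; rewrite -size_eq0 size_rev size_eq0.
  + by move=> i; have := UM i; rewrite /= cats1 rcons_uniq mem_rev rev_uniq.
  + move=> w; case: (coverM w) => [|[i wi]]; first by rewrite inE => /eqP; left.
    by right; exists i; rewrite mem_rev.
  + move=> i j ij w z wS zS; rewrite ring_pair_rev // (adjM _ _ ij) //.
      by move: wS; rewrite !inE !mem_cat !mem_rev !inE; case: (w == y); rewrite ?orbT.
    by move: zS; rewrite !inE !mem_cat !mem_rev !inE; case: (z == y); rewrite ?orbT.
  + by move=> i j ij; rewrite !size_rev; apply: szM ij.
- constructor 2; rewrite E0' Ex in UM coverM adjM szM.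
  apply: (@ring_pyramid G M dM M0 x) => //.
  + by move=> i; have := UM i; rewrite cats0.
  + by move=> w; case: (coverM w) => [|[i wi]]; [rewrite inE => /eqP; left|right; exists i].
  + by apply: szM.
constructor 3; rewrite Ex Ey in UM coverM adjM.
exact: (ring_theta dM M0 UM coverM adjM).
Qed.

End LinkedHole.

(** * Induction on the number of vertices, and the equivalences *)

Lemma embedding_has_induced (H G : sgraph) (f : H -> G) :
  embedding f -> has_induced G H.
Proof.
move=> [f_inj f_adj]; exists (f @: [set: H]).
have fS h : f h \in f @: [set: H] by rewrite imset_f.
pose g h : induced (f @: [set: H]) := exist _ (f h) (fS h).
have g_inj : injective g by move=> h k /(congr1 val) /f_inj.
have [|g' gK g'K] := inj_card_bij g_inj.
  by rewrite card_induced card_imset // cardsT.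
exists g'; first by exists g.
by move=> u v; rewrite -[in RHS](g'K u) -[in RHS](g'K v) -f_adj.
Qed.

Lemma obstruction_free_induced (G : sgraph) (S : {set G}) :
  obstruction_free G -> obstruction_free (induced S).
Proof.
move=> oG H HH /has_induced_embedding[f [f_inj f_adj]]; apply: oG HH _.
apply: (@embedding_has_induced _ _ (val \o f)); split; last by move=> u v; rewrite -f_adj.
by move=> u v /val_inj/f_inj.
Qed.

Lemma obstruction_free_not_obstruction G : obstruction_free G -> ~ obstruction G.
Proof.
move=> oG GG; apply: oG GG _.
by apply: (@embedding_has_induced _ _ id); split=> // u v.
Qed.

Lemma hole_map (H G : sgraph) (f : H -> G) c : embedding f -> hole (map f c) -> hole c.
Proof.
case=> f_inj f_adj [Uc c4 adjc]; rewrite map_inj_uniq // in Uc; rewrite size_map in c4.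
split=> // u v uc vc; rewrite -f_adj adjc ?map_f // cycle_edge_map //.
Qed.

Lemma linked_map (H G : sgraph) (f : H -> G) c p u v : embedding f ->
  linked (mem (map f c)) (far_in (map f c)) (map f p) (f u) (f v) ->
  linked (mem c) (far_in c) p u v.
Proof.
case=> f_inj f_adj; case: p => [|a s]; rewrite /linked.
  by case/and5P=> _ _ _; rewrite /= adj_irrefl.
rewrite /far_in !(mem_map f_inj) (inj_eq f_inj) !f_adj.
case/and5P=> -> sp Dp /=; rewrite last_map !f_adj => -> ->; rewrite /= andbT.
apply/andP; split.
  by move: sp; rewrite /= path_map (eq_path (e' := @adj H)).
move: Dp; rewrite /= (mem_map f_inj) all_map => /andP[->].
by rewrite (eq_all (a2 := predC (mem c))) // => w /=; rewrite (mem_map f_inj).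
Qed.

(* In a graph with the fewest vertices, the hole and a shortest link cover everything. *)
Lemma hole_unlinked (G : sgraph) (c p : seq G) (u v : G) : obstruction_free G -> hole c ->
  ~~ linked (mem c) (far_in c) p u v.
Proof.
move: {2}#|G|.+1 (ltnSn #|G|) => n.
elim: n => // n IHn in G c p u v *; rewrite ltnS => Gn oG hc; apply/negP => lp.
have {p u v lp}[a [s [u [v sl]]]] := exists_shortest_link lp.
have [lp _ _ _ _] := sl.
have [cover|] := boolP [forall w, (w \in c) || (w \in a :: s)].
  have {}cover w : w \in c \/ w \in a :: s by apply/orP; move/forallP: cover.
  apply: (obstruction_free_not_obstruction oG).
  case: (altP (s =P [::])) => [E|s0].
    constructor 1; rewrite E in lp cover; apply: short_link_wheel hc _ _ _ lp _ => w.
    by case: (cover w); [left|rewrite inE => /eqP; right].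
  have [/hasP[w wc /andP[/hasP[b bb wb] /hasP[b' bs wb']]]|none] :=
      boolP (has (fun w => has (adj w) (belast a s) && has (adj w) s) c).
    by constructor 1; apply: common_attachment_wheel hc _ _ _ _ _ _ _ sl cover wc bb wb bs wb'.
  have sep w b b' : w \in c -> b \in belast a s -> b' \in s -> adj w b -> ~~ adj w b'.
    move=> wc bb bs wb; apply: contraNN none => wb'; apply/hasP; exists w => //.
    by apply/andP; split; apply/hasP; [exists b|exists b'].
  by case: (separate_attachments_ring hc sl cover s0 sep) => ?;
    [constructor 2|constructor 3|constructor 4].
rewrite negb_forall => /existsP[w]; rewrite negb_or => /andP[wc wp].
pose S := [set z in c ++ (a :: s)].
have cS z : z \in c -> z \in S by rewrite in_set mem_cat => ->.
have pS z : z \in a :: s -> z \in S by move=> zp; rewrite in_set mem_cat zp orbT.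
have [|c' Ec] := @seq_preimage _ (induced S) val c.
  by move=> z /cS; apply: induced_preimage.
have [|p' Ep] := @seq_preimage _ (induced S) val (a :: s).
  by move=> z /pS; apply: induced_preimage.
have /and5P[/and4P[uc vc _ _] _ _ _ _] := lp.
have [u' Eu] := induced_preimage (cS _ uc); have [v' Ev] := induced_preimage (cS _ vc).
have SG : #|induced S| < n.
  rewrite card_induced (leq_trans _ Gn) // -cardsT proper_card // properT.
  by apply: contraTneq (in_setT w) => <-; rewrite in_set mem_cat negb_or wc.
have vE := induced_embedding S.
have := IHn (induced S) c' p' u' v' SG (obstruction_free_induced oG).
rewrite Ec in hc; rewrite Ec Ep -Eu -Ev in lp.
by rewrite (linked_map vE lp) => /(_ (hole_map vE hc)).
Qed.

(** Sequences without repetition have at most [#|G|] entries, so the search for a hole is finite and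
    decidable. On a long cycle that is not a hole, adjacency and cycle edges disagree somewhere;
    cycle edges being adjacent, this is a chord. *)
Lemma chordal_or_hole G : chordal G \/ exists c : seq G, hole c.
Proof.
pose holeb (c : seq G) := [&& uniq c, 4 <= size c &
  [forall u in c, forall v in c, adj u v == cycle_edge c u v]].
have [/existsP[n /existsP[c /and3P[Uc c4 /forall_inP adjc]]]|none] :=
    boolP [exists n : 'I_#|G|.+1, exists c : n.-tuple G, holeb c].
  right; exists c; split=> // u v uc vc.
  by have /forall_inP/(_ v vc)/eqP := adjc u uc.
left=> c cc c4; have /and3P[_ _ Uc] := cc.
have szc : size c < #|G|.+1 by rewrite ltnS -(card_uniqP Uc) max_card.
move: none; rewrite negb_exists => /forallP/(_ (Ordinal szc)).
rewrite negb_exists => /forallP/(_ (in_tuple c)).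
rewrite /holeb Uc c4 /= negb_forall_in => /exists_inP[u uc].
rewrite negb_forall_in => /exists_inP[v vc] nuv; exists u, v; split=> //.
  apply: contraNT nuv => nuv; rewrite (negPf nuv) eq_sym; apply/eqP.
  by apply: contraNF nuv; apply: cycle_seq_edge.
by apply: contraNN nuv => cuv; rewrite cuv (cycle_seq_edge cc cuv).
Qed.

Lemma obstruction_free_constructible G : obstruction_free G ->
  constructible (fun k => k <= 2) (fun H => chordal H \/ cycle_graph H) G.
Proof.
move: {2}#|G|.+1 (ltnSn #|G|) => n.
elim: n => // n IHn in G *; rewrite ltnS => Gn oG.
case: (chordal_or_hole G) => [chG|[c hc]]; first by apply: Constr_base; left.
have [Uc c4 adjc] := hc.
have [cT|] := boolP [forall v, v \in c].
  apply: Constr_base; right; exists c; split; last by move=> u v; rewrite adjc // (forallP cT).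
    exact: is_cycle_seq_chordless (ltnW c4) adjc.
  exact/forallP.
rewrite negb_forall => /existsP[y yc].
have Kc k := neighbourhood_component (D := mem c) yc (k := k).
have clK : {in neighbourhood (component (mem c) y) &, forall u v, u != v -> adj u v}.
  move=> u v uK vK uv; apply: (far_inN (Kc _ uK) (Kc _ vK) uv); apply/negP => far_uv.
  have [p] := neighbourhood_linked yc uK vK far_uv.
  by apply/negP; apply: hole_unlinked.
(* The bound 2 on the clique-sums comes from here: a hole contains no three pairwise adjacent
   vertices. *)
have K2 : #|neighbourhood (component (mem c) y)| <= 2.
  rewrite leqNgt; apply/negP => /card_gt2P[u [v [w [[uK vK wK] [uv vw wu]]]]].
  have := hole_triangle_free hc (Kc _ uK) (Kc _ vK) (Kc _ wK) (clK _ _ uK vK uv).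
  by rewrite !clK // 1?eq_sym // => /(_ isT).
apply: (constructible_neighbourhood (H := component (mem c) y)) => //.
- by apply/set0Pn; exists y; rewrite inE.
(* The hole avoids the component, so its four or more vertices would all be among at most two
   neighbours. *)
- apply/negP => /eqP HT.
  have : #|c| <= #|neighbourhood (component (mem c) y)|.
    apply/subset_leq_card/subsetP => v vc; have := in_setT v; rewrite -HT inE.
    by case/orP=> // /(component_avoids yc)/negP/(_ vc).
  by rewrite (card_uniqP Uc) => /leq_trans/(_ K2); rewrite leqNgt (leq_trans _ c4).
move=> S SG; apply: IHn; last exact: obstruction_free_induced.
by rewrite card_induced (leq_trans SG).
Qed.

Lemma constructible_chordal_complete G :
  constructible (fun k => k <= 2) (fun H => chordal H \/ cycle_graph H) G ->
  constructible predT (fun H => complete_graph H \/ cycle_graph H) G.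
Proof.
elim=> {G} [G [chG|cG]|k G1 G2 G _ _ c1 _ c2 cs].
- by apply: chordal_constructible chG => H; left.
- by apply: Constr_base; right.
exact: Constr_sum c1 c2 cs.
Qed.

Theorem theorem4p21 (G : sgraph) :
  [<-> theta_ring G;
       constructible (fun k => k <= 2) (fun H => chordal H \/ cycle_graph H) G;
       constructible predT (fun H => complete_graph H \/ cycle_graph H) G;
       forall H : sgraph,
         [\/ theta_partial_wheel H, prism H, pyramid H | theta H] ->
         ~ has_induced G H].
Proof.
(* The four implications asked for follow the listed order; they are composed from the arrows (i) to
   (iv), (iv) to (ii), (ii) to (iii) and (iii) to (i). *)
tfae.
- by move/theta_ring_obstruction_free/obstruction_free_constructible.
- exact: constructible_chordal_complete.
- by move/constructible_theta_ring/theta_ring_obstruction_free.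
move/obstruction_free_constructible/constructible_chordal_complete.
exact: constructible_theta_ring.
Qed.
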